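(* Let $C$ be a longest cycle in a $(\delta-\lambda+1)$-connected graph $G$ of order $n$, where $\lambda$ is an integer with $1\le\lambda\le\delta$. If $\delta\geq \frac{n+2}{\lambda+1}+\lambda-2$, then $\overline{c}\leq \lambda-1$.
   Context: All graphs are finite, undirected, without loops or multiple edges. For a graph $G$ on $n$ vertices, $\delta$ denotes its minimum degree and $\kappa$ its connectivity. A cycle of order $t$ is a sequence $v_1\dots v_tv_1$ of distinct vertices with consecutive vertices adjacent; a single vertex is a cycle of order 1 and an edge a cycle of order 2. $C$ is a longest cycle of $G$, $c=|C|$ is the circumference, and $\overline{c}$ denotes the order of a longest cycle in $G-C$ (the subgraph obtained by deleting the vertices of $C$); $\overline{c}\le 0$ if $G-C$ is empty. *)

(* Defs.v *)
From mathcomp Require Import all_boot all_order all_algebra.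

Set Implicit Arguments.
Unset Strict Implicit.
Unset Printing Implicit Defensive.

(* A finite simple graph is a symmetric irreflexive relation on a
   finite type of vertices; the definitions below take the bare relation. *)

Section Graph.

Variables (V : finType) (adj : rel V).

Definition degree (x : V) : nat := #|[set y | adj x y]|.

(* Degrees never exceed #|V|, so the default #|V| matters only when V is
   empty, where it gives 0. *)
Definition min_degree : nat := \big[minn/#|V|]_(x : V) degree x.

(* The subgraph induced by A is connected. *)
Definition connected_on (A : {set V}) : bool :=
  [forall x in A, forall y in A,
     connect [rel u v | [&& u \in A, v \in A & adj u v]] x y].

(* Least number of vertices whose deletion leaves a disconnected graph or at
   most one vertex; in particular it is #|V| - 1 for a complete graph.  The
   default #|V| is harmless, since S = setT always qualifies. *)
Definition connectivity : nat :=
  \big[minn/#|V|]_(S : {set V} |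
     ~~ connected_on (~: S) || (#|~: S| <= 1)) #|S|.

Definition k_connected (k : nat) : bool := k <= connectivity.

(* A single vertex is a cycle of order 1; it needs its own clause because
   cycle adj [:: x] unfolds to adj x x, which is false.  For two vertices,
   cycle adj [:: x; y] holds exactly when they are adjacent. *)
Definition is_cycle (s : seq V) : bool :=
  [&& 0 < size s, uniq s & (size s == 1) || cycle adj s].

Definition longest_cycle (s : seq V) : Prop :=
  is_cycle s /\ forall s', is_cycle s' -> size s' <= size s.

(* Order of a longest cycle of the subgraph induced by A; 0 if A is empty. *)
Definition max_cycle_order (A : {set V}) : nat :=
  \max_(t < #|V|.+1 |
     [exists s : t.-tuple V, is_cycle s && all [in A] s]) t.

(* Order of a longest cycle of G - C. *)
Definition cbar (C : seq V) : nat := max_cycle_order [set x | x \notin C].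

End Graph.

(* Main.v *)
(* Write k = delta - lambda + 1, so that n + 2 <= (lambda + 1)(k + 1), and
   suppose that a longest cycle Q of G - C has order h >= lambda.

   Attach to the vertices of Q disjoint paths outside C (the spokes, some of
   them empty) of maximal total length.  Their tips have small degree outside
   C, hence many neighbours on C, and since C is longest a suitably weighted
   sum of these degrees is at most a multiple of |C|.  This gives
     n >= (h + 1)(delta - h + 2) - 1 + f
       = (lambda + 1)(k + 1) - 1 - (h - lambda)(h - k) + f,
   where f >= 0 measures adjacencies missing on Q.  So h > lambda and h > k.

   Then there are t = min(k, lambda + 1) disjoint paths from Q to C.  If the
   ends on C of any two of them are joined outside C through at least t - 1
   vertices, the successors on C of these ends have degree sum so small that
   n - h >= t (delta + 2 - t) = k (lambda + 1), which is too much.  Otherwise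
   two of these paths admit only short detours, which forbids so many chords of Q
   near their ends that f >= j ^ 2 with j = h + 1 - t; now
   j ^ 2 >= (h - lambda)(h - k) contradicts the displayed bound. *)

Require Import Defs.
From Stdlib Require Import Classical IndefiniteDescription.
From mathcomp Require Import all_boot all_order all_algebra.
From mathcomp Require Import zify.

Set Implicit Arguments.
Unset Strict Implicit.
Unset Printing Implicit Defensive.

(** * Walks and cycles *)

(** The value t = min(k, lambda + 1) comes from t (delta + 2 - t), which equals k (lambda + 1) both
    at t = k and at t = lambda + 1, while t <= k is what connectivity can provide. The same t serves
    the other alternative: a detour with fewer than t - 1 vertices falls short of h by more than j =
    h + 1 - t, and j is at least h - lambda and at least h - k.

    The obstacle in the bound on n is that a vertex of Q without a spoke is only known to have at
    most 2 (h - 1) neighbours outside C, too many for a plain average. A spoke with p > 0 vertices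
    beyond Q has a tip with at most (h - 1 + p) / 2 such neighbours, and its p vertices count
    towards n as well. The weights are therefore distributed over the edges of Q, and an edge with
    just one bare end gives nearly everything to the other end. What this mixed case leaves over, (h
    - 1) (h - 2), is the room in which missing adjacencies can be charged to an edge whatever the
    spokes at its ends are. *)

Section Chains.

Variables (T : eqType) (e : rel T).
Implicit Types (x y z : T) (s : seq T).

(** Unlike in [path], the list contains both end vertices, which makes reversal and concatenation
    symmetric and the size a count of vertices. *)
Definition chain x s y : bool :=
  if s is a :: p then [&& a == x, path e x p & last x p == y] else false.

Lemma chain1 x : chain x [:: x] x.
Proof. by rewrite /= !eqxx. Qed.

Lemma chain_cat x y y' z s s' :
  chain x s y -> e y y' -> chain y' s' z -> chain x (s ++ s') z.
Proof.
case: s => [//|a p] /= /and3P[/eqP-> ep /eqP <-] eyy'.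
case: s' => [//|b q] /= /and3P[/eqP-> eq /eqP <-].
by rewrite eqxx cat_path ep /= eyy' eq last_cat /= eqxx.
Qed.

Lemma chain_rev x s y : symmetric e -> chain x s y -> chain y (rev s) x.
Proof.
move=> e_sym; case: s => [//|a p] /= /and3P[/eqP-> ep /eqP <-].
elim/last_ind: p ep => [|p b IH] /=; first by rewrite /rev /= !eqxx.
rewrite rcons_path last_rcons => /andP[ep eb].
rewrite -rcons_cons rev_rcons /= eqxx /=.
have := IH ep; case: (rev (x :: p)) => [//|c q] /= /and3P[/eqP-> ->  /eqP->].
by rewrite e_sym eb eqxx.
Qed.

Lemma chain_cons x y z s : e x y -> chain y s z -> chain x (x :: s) z.
Proof. by move=> exy cs; apply: (chain_cat (chain1 x) exy cs). Qed.

Lemma chain_rcons x y z s : chain x s y -> e y z -> chain x (rcons s z) z.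
Proof. by move=> cs eyz; rewrite -cats1; apply: chain_cat cs eyz (chain1 z). Qed.

Lemma chain_cycle x s y : chain x s y -> e y x -> cycle e s.
Proof.
by case: s => [//|a p] /= /and3P[/eqP-> ep /eqP <-]; rewrite rcons_path ep.
Qed.

Lemma chain_size x s y : chain x s y -> 0 < size s.
Proof. by case: s. Qed.

Lemma chain_head x s y : chain x s y -> x \in s.
Proof. by case: s => [//|a p] /= /and3P[/eqP-> _ _]; rewrite mem_head. Qed.

Lemma chain_last x s y : chain x s y -> y \in s.
Proof. by case: s => [//|a p] /= /and3P[/eqP-> _ /eqP<-]; rewrite mem_last. Qed.

Lemma chain_headE x a s y : chain x (a :: s) y -> a = x.
Proof. by case/and3P=> /eqP. Qed.

Lemma chain_lastE x a s y : chain x (rcons s a) y -> a = y.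
Proof. by case: s => [|b s] /and3P[/eqP ax _ /eqP] /=; rewrite ?last_rcons // ax. Qed.

Lemma chain_split x s1 z s2 y :
  chain x (s1 ++ z :: s2) y = chain x (rcons s1 z) z && chain z (z :: s2) y.
Proof.
case: s1 => [|a p] /=; first by rewrite !eqxx; case: (eqVneq z x) => [->|]; rewrite ?eqxx /=.
rewrite rcons_path last_rcons !eqxx cat_path last_cat /= !andbT.
by case: (a == x); rewrite //= -!andbA.
Qed.

Lemma chain_prefix x s y z : chain x s y -> z \in s ->
  exists s1 s2, [/\ s = s1 ++ z :: s2, chain x (rcons s1 z) z & chain z (z :: s2) y].
Proof.
move=> cs /splitPr zs; case: zs cs => s1 s2.
by rewrite chain_split => /andP[c1 c2]; exists s1, s2.
Qed.

End Chains.

Lemma chain_mono (T : eqType) (e e' : rel T) x s y :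
  {in s &, forall a b, e a b -> e' a b} -> chain e x s y -> chain e' x s y.
Proof.
case: s => [//|a p] sub /= /and3P[/eqP ax ep ->]; rewrite ax eqxx andbT /=.
rewrite ax in sub => {a ax}.
elim: p x sub ep => //= b p IH x sub /andP[exb ep].
rewrite sub ?inE ?eqxx ?orbT //= IH //.
by move=> c d cp dp; apply: sub; rewrite inE ?cp ?dp orbT.
Qed.

Section CyclicWalks.

Variables (T : eqType) (e : rel T).

(* A cycle of order h as an h-periodic sequence; as in is_cycle, a single
   vertex needs no edge. *)
Record cyclic_walk (u : nat -> T) (h : nat) : Prop := CyclicWalk {
  cw_gt0 : 0 < h;
  cw_period : forall i, u (i + h) = u i;
  cw_inj : forall i j, i < h -> j < h -> u i = u j -> i = j;
  cw_adj : forall i, 1 < h -> e (u i) (u i.+1) }.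

Definition warc (u : nat -> T) i n := [seq u t | t <- iota i n].

Lemma size_warc u i n : size (warc u i n) = n.
Proof. by rewrite size_map size_iota. Qed.

Lemma warcD u i m n : warc u i (m + n) = warc u i m ++ warc u (i + m) n.
Proof. by rewrite /warc iotaD map_cat. Qed.

Lemma mem_warc u i n x : reflect (exists2 t, i <= t < i + n & x = u t) (x \in warc u i n).
Proof.
apply: (iffP mapP) => [[t]|[t]] H ->; exists t => //; move: H;
by rewrite mem_iota.
Qed.

Section Walk.

Variables (u : nat -> T) (h : nat) (uh : cyclic_walk u h).
Let h_gt0 := cw_gt0 uh.

Lemma cw_modn i : u (i %% h) = u i.
Proof.
rewrite {2}(divn_eq i h) addnC; elim: (i %/ h) => [|q IH]; first by rewrite addn0.
by rewrite mulSnr addnA (cw_period uh).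
Qed.

Lemma cw_eq i j : (u i == u j) = (i == j %[mod h]).
Proof.
apply/eqP/eqP => [|E]; last by rewrite -cw_modn E cw_modn.
rewrite -(cw_modn i) -(cw_modn j); apply: (cw_inj uh); exact: ltn_pmod.
Qed.

Lemma cw_periodM i q : u (i + q * h) = u i.
Proof. by apply/eqP; rewrite cw_eq addnC modnMDl. Qed.

Lemma cw_rot r : cyclic_walk (fun i => u (r + i)) h.
Proof.
split=> // [i|i j ih jh|i h1].
- by rewrite addnA (cw_period uh).
- by move/eqP; rewrite cw_eq eqn_modDl !modn_small // => /eqP.
- by rewrite addnS; apply: cw_adj uh _ h1.
Qed.

Lemma cw_eq_small i j : i < j -> j < i + h -> u i = u j -> False.
Proof.
move=> ij ji /eqP; rewrite cw_eq -{1}(addn0 i).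
have ->: j = i + (j - i) by lia.
rewrite eqn_modDl mod0n modn_small ?lia; lia.
Qed.

Lemma uniq_warc i n : n <= h -> uniq (warc u i n).
Proof.
move=> nh; rewrite map_inj_in_uniq ?iota_uniq // => a b.
rewrite !mem_iota => ha hb E.
case: (ltngtP a b) => // ab; exfalso; first by apply: (cw_eq_small ab _ E); lia.
by apply: (cw_eq_small ab _ (esym E)); lia.
Qed.

Lemma mem_warc_full i x : reflect (exists t, x = u t) (x \in warc u i h).
Proof.
apply: (iffP (mem_warc _ _ _ _)) => [[t _ ->]|[t ->]]; first by exists t.
(* The least index from [i] on that is congruent to [t]; the summand [i * h] keeps the subtraction
   from truncating. *)
exists (i + (t + i * h - i) %% h); first by have := ltn_pmod (t + i * h - i) h_gt0; lia.
apply/eqP; rewrite cw_eq modnDmr.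
have -> : i + (t + i * h - i) = i * h + t by nia.
by rewrite modnMDl.
Qed.

Lemma chain_warc i n : n < h -> chain e (u i) (warc u i n.+1) (u (i + n)).
Proof.
case: (ltnP 1 h) => [h1 _|h1 nh]; last first.
  have -> : n = 0 by lia.
  by rewrite addn0; apply: chain1.
elim: n => [|n IH]; first by rewrite addn0; exact: chain1.
have -> : warc u i n.+2 = rcons (warc u i n.+1) (u (i + n.+1)).
  by rewrite -cats1 -(addn1 n.+1) warcD.
by apply: chain_rcons IH _; rewrite addnS; apply: cw_adj uh _ h1.
Qed.

End Walk.

Lemma warc_rot u r i n : warc (fun t => u (r + t)) i n = warc u (r + i) n.
Proof. by rewrite /warc iotaDl -map_comp. Qed.

End CyclicWalks.

(** * Menger's theorem *)

Section Menger.

Variable V : finType.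
Implicit Types (e : rel V) (A B S : {set V}).

(** The last vertex is never the tail of an edge. In [menger], a path that meets [x |: S] only at
    its end therefore avoids the deleted edge out of [x]. *)
Lemma chain_mono_source e e' x s z :
  (forall a b, a \in s -> e a b -> e' a b) -> chain e x (rcons s z) z -> chain e' x (rcons s z) z.
Proof.
case: s => [//|a p] sub /=; rewrite !last_rcons eqxx !andbT => /andP[/eqP ax].
rewrite ax in sub *; rewrite eqxx /= => {a ax}.
elim: p x sub => [|b p IH] x sub /=; first by rewrite !andbT; apply: sub; rewrite inE.
case/andP=> exb pb; rewrite sub ?inE ?eqxx //=; apply: IH pb => c d cp.
by apply: sub; rewrite inE cp orbT.
Qed.

(** The dual form: a path that meets [y |: S] only at its start has no edge into [y]. *)
Lemma chain_mono_target e e' x s z :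
  (forall a b, b \in s -> e a b -> e' a b) -> chain e x (x :: s) z -> chain e' x (x :: s) z.
Proof.
move=> sub /=; rewrite !eqxx /= => /andP[+ ->]; rewrite andbT.
elim: s x sub => //= b p IH x sub /andP[exb pb]; rewrite sub ?inE ?eqxx //=.
by apply: IH pb => c d dp; apply: sub; rewrite inE dp orbT.
Qed.

Definition separates e A B S :=
  forall x s y, chain e x s y -> x \in A -> y \in B -> exists2 z, z \in s & z \in S.

Definition link e A B (x : V) s (y : V) : Prop :=
  [/\ chain e x s y, uniq s, x \in A, y \in B &
      forall z, z \in s -> (z \in A -> z = x) /\ (z \in B -> z = y)].

Definition linkage e A B k (F : 'I_k -> seq V) : Prop :=
  (forall i, exists x y, link e A B x (F i) y) /\
  (forall i j z, z \in F i -> z \in F j -> i = j).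

(** A vertex of [A] other than the start, or of [B] other than the end, cuts off a strictly shorter
    path; repeat until there is none. *)
Lemma trim_chain e A B x s y : chain e x s y -> x \in A -> y \in B ->
  exists x' s' y', {subset s' <= s} /\ link e A B x' s' y'.
Proof.
have uniq_case n : forall x s y, size s < n -> chain e x s y -> uniq s -> x \in A -> y \in B ->
  exists x' s' y', {subset s' <= s} /\ link e A B x' s' y'.
  elim: n => // n IH {}x {}s {}y sn cs us xA yB.
  case: (classic (forall z, z \in s -> (z \in A -> z = x) /\ (z \in B -> z = y))) => [H|H].
    by exists x, s, y; split.
  have [z Hz] := not_all_ex_not _ _ H.
  have [zs nz] := imply_to_and _ _ Hz.
  have [s1 [s2 [E c1 c2]]] := chain_prefix cs zs.
  case: (not_and_or _ _ nz) => nz'; have [zT ne] := imply_to_and _ _ nz'; last first.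
    case: s2 E c2 => [|a s2] E c2.
      by case: ne; apply: (@chain_lastE _ _ z z [::]) c2.
    have [||x' [s' [y' [sub l]]]] := IH _ _ _ _ c1 _ xA zT.
    - by move: sn; rewrite E size_rcons size_cat /=; lia.
    - by move: us; rewrite E -cat_rcons cat_uniq => /and3P[].
    by exists x', s', y'; split=> // t /sub; rewrite E -cat_rcons mem_cat => ->.
  case: s1 E c1 => [|a s1] E c1.
    by case: ne; move: cs; rewrite E => /chain_headE.
  have [||x' [s' [y' [sub l]]]] := IH _ _ _ _ c2 _ zT yB.
  - by move: sn; rewrite E /= size_cat /=; lia.
  - by move: us; rewrite E cat_uniq => /and3P[].
  by exists x', s', y'; split=> // t /sub; rewrite E mem_cat => ->; rewrite orbT.
case: s => [//|a p] /= /and3P[/eqP-> ep /eqP E] xA yB.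
case: (shortenP ep) E => p' ep' up' sub E.
have [||//|//|x' [s' [y' [sub' l]]]] := uniq_case _ x (x :: p') y (ltnSn _).
- by rewrite /= eqxx ep' E eqxx.
- exact: up'.
exists x', s', y'; split=> // t /sub'; rewrite !inE => /orP[->//|tp].
by rewrite (sub _ tp) orbT.
Qed.

Lemma trim_family e A B k (F : 'I_k -> seq V) :
  (forall i, exists x y, [/\ chain e x (F i) y, x \in A & y \in B]) ->
  (forall i j z, z \in F i -> z \in F j -> i = j) ->
  exists F', linkage e A B F' /\ forall i, {subset F' i <= F i}.
Proof.
move=> cF dF.
have H i : exists s', {subset s' <= F i} /\ exists x y, link e A B x s' y.
  have [x [y [cs xA yB]]] := cF i.
  have [x' [s' [y' [sub l]]]] := trim_chain cs xA yB.
  by exists s'; split=> //; exists x', y'.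
have [F' HF'] : exists F' : 'I_k -> seq V, forall i, {subset F' i <= F i} /\
    exists x y, link e A B x (F' i) y.
  exact: functional_choice H.
exists F'; split; last by move=> i; case: (HF' i).
split=> [i|i j z zi zj]; first by case: (HF' i).
by apply: (dF i j z); [case: (HF' i) => ->|case: (HF' j) => ->].
Qed.

(** Pigeonhole: [k] disjoint links start at distinct vertices of a set with [k] elements, so every
    element is a start. *)
Lemma link_start_bij e A B k (F : 'I_k -> seq V) : linkage e A B F -> #|A| = k ->
  forall x, x \in A -> exists i y, link e A B x (F i) y.
Proof.
move=> [cF dF] cA y yB.
pose g i := [pick z in A | z \in F i].
have gP i : exists x y, link e A B x (F i) y /\ g i = Some x.
  have [x [t l]] := cF i; exists x, t; split=> //.
  rewrite /g; case: pickP => [z /andP[zB zF]|].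
    by case: l => _ _ _ _ /(_ z zF) [->].
  by case: l => cs _ tB _ _ /(_ x); rewrite tB (chain_head cs).
have g_inj : injective g.
  move=> i j; have [x [t [l ->]]] := gP i; have [x' [t' [l' ->]]] := gP j.
  case=> E; subst x'; apply: (dF i j x).
    by case: l => /chain_head.
  by case: l' => /chain_head.
pose D := [set Some z | z in A].
have cD : #|D| = k by rewrite card_imset // => a b [].
have sub : [set g i | i in 'I_k] \subset D.
  apply/subsetP => o /imsetP[i _ ->]; have [x [t [[_ _ tB _ _] ->]]] := gP i.
  exact: imset_f.
have E : [set g i | i in 'I_k] = D.
  by apply/eqP; rewrite eqEcard sub /= cD card_imset // card_ord.
have : Some y \in D by apply: imset_f.
rewrite -E => /imsetP[i _ Ey].
have [x [t [l]]] := gP i; rewrite -Ey => -[yt].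
by exists i, t; rewrite yt.
Qed.

(* Göring's proof: delete an edge xy; a small separator S of the rest extends
   to both x |: S and y |: S, and the two halves are linked by induction. *)
Theorem menger e A B k : (forall S, separates e A B S -> k <= #|S|) ->
  exists F : 'I_k -> seq V, linkage e A B F.
Proof.
have [m] := ubnP #|[set p : V * V | e p.1 p.2]|.
elim: m e A B => // m IH e A B em sepk.
case: (set_0Vmem [set p : V * V | e p.1 p.2]) => [e0|[[x y]]].
  have E0 a b : e a b = false.
    by apply/negP => ab; have := in_set0 (a, b); rewrite -e0 inE /= ab.
  (* Without edges every path is a single vertex, so [A :&: B] separates and its vertices are the
     required paths. *)
  have kAB : k <= #|A :&: B|.
    apply: sepk => a s b; case: s => [//|c p] /= /and3P[/eqP-> + /eqP <-].
    case: p => [_ aA aB|d p /=]; last by rewrite E0.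
    by exists a; rewrite ?mem_head // inE aA.
  have kE : k <= size (enum (A :&: B)) by rewrite -cardE.
  pose f (i : 'I_k) := enum_val (widen_ord kAB i).
  have fAB i : f i \in A :&: B by apply: enum_valP.
  exists (fun i => [:: f i]); split=> [i|i j z].
    have := fAB i; rewrite inE => /andP[fA fB]; exists (f i), (f i).
    split=> //; first by rewrite /= !eqxx.
    by move=> z; rewrite inE => /eqP->.
  rewrite !inE => /eqP-> /eqP /enum_val_inj /(congr1 val) /= E; exact: val_inj.
rewrite inE /= => exy.
pose e' := [rel a b | e a b && ((a, b) != (x, y))].
have e'm : #|[set p : V * V | e' p.1 p.2]| < m.
  rewrite -ltnS; apply: leq_trans em; rewrite ltnS; apply: proper_card; apply/properP; split.
    by apply/subsetP => -[a b]; rewrite !inE /= => /andP[].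
  by exists (x, y); rewrite !inE /= ?exy ?eqxx.
have e'e : subrel e' e by move=> a b /= /andP[].
case: (classic (forall S, separates e' A B S -> k <= #|S|)) => [H|].
  have [F [cF dF]] := IH _ _ _ e'm H; exists F; split=> // i.
  have [a [b [c uF aA bB t]]] := cF i; exists a, b; split=> //.
  by apply: chain_mono c => ? ? _ _; apply: e'e.
move=> nH; have [S HS] := not_all_ex_not _ _ nH.
have [sepS /negP] := imply_to_and _ _ HS; rewrite -ltnNge => Sk.
have sep_x a s b : chain e a s b -> a \in A -> b \in B ->
    exists2 z, z \in s & z \in x |: S.
  move=> c aA bB; case: (boolP (x \in s)) => xs; first by exists x; rewrite // setU11.
  have [|z zs zS] := sepS a s b _ aA bB.
    apply: chain_mono c => p q ps _ epq /=; rewrite epq /=.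
    by apply: contra xs => /eqP[<- _].
  by exists z; rewrite // inE zS orbT.
have sep_y a s b : chain e a s b -> a \in A -> b \in B ->
    exists2 z, z \in s & z \in y |: S.
  move=> c aA bB; case: (boolP (y \in s)) => xs; first by exists y; rewrite // setU11.
  have [|z zs zS] := sepS a s b _ aA bB.
    apply: chain_mono c => p q _ qs epq /=; rewrite epq /=.
    by apply: contra xs => /eqP[_ <-].
  by exists z; rewrite // inE zS orbT.
(* Both extensions of [S] separate in the full graph, so each has at least [k] elements, while [S]
   has fewer. *)
have kx := sepk _ sep_x; have ky := sepk _ sep_y.
have [xS yS cS] : [/\ x \notin S, y \notin S & #|S|.+1 = k].
  move: kx ky; rewrite !cardsU1; case: (x \in S); case: (y \in S) => /=; split=> //; lia.
have cx : #|x |: S| = k by rewrite cardsU1 xS.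
have cy : #|y |: S| = k by rewrite cardsU1 yS.
(* A set separating [A] from [x |: S] without the edge also separates [A] from [B] with it: every
   path from [A] to [B] meets [x |: S], and its part up to there, once trimmed, avoids the edge. *)
have [F [cF dF]] : exists F : 'I_k -> seq V, linkage e' A (x |: S) F.
  apply: IH e'm _ => S' sepS'; apply: sepk => a s b c aA bB.
  have [p ps pX] := sep_x _ _ _ c aA bB.
  have [s1 [s2 [Es c1 c2]]] := chain_prefix c ps.
  have [a' [s' [p' [sub [c' us' a'A p'X tr]]]]] := trim_chain c1 aA pX.
  have [|z zs' zS'] := sepS' a' s' p' _ a'A p'X.
    case/lastP: s' {sub} c' us' tr => [//|s' p''] c' us' tr.
    have Ep := chain_lastE c'.
    subst p''; apply: (chain_mono_source _ c') => f g fs efg /=; rewrite efg /=.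
    apply/eqP => -[fx _]; subst f; move: us'; rewrite rcons_uniq.
    have [|_] := tr x; first by rewrite mem_rcons inE fs orbT.
    by move=> /(_ (setU11 _ _)) <-; rewrite fs.
  exists z => //; have := sub z zs'; rewrite Es -cat_rcons mem_cat => -> //.
have [F' [cF' dF']] : exists F : 'I_k -> seq V, linkage e' (y |: S) B F.
  apply: IH e'm _ => S' sepS'; apply: sepk => a s b c aA bB.
  have [p ps pX] := sep_y _ _ _ c aA bB.
  have [s1 [s2 [Es c1 c2]]] := chain_prefix c ps.
  have [p' [s' [b' [sub [c' us' p'X b'B tr]]]]] := trim_chain c2 pX bB.
  have [|z zs' zS'] := sepS' p' s' b' _ p'X b'B.
    case: s' {sub} c' us' tr => [//|p'' s'] c' us' tr.
    have Ep := chain_headE c'.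
    subst p''; apply: (chain_mono_target _ c') => f g gs efg /=; rewrite efg /=.
    apply/eqP => -[_ gy]; subst g; move: us'; rewrite cons_uniq.
    have [] := tr y; first by rewrite inE gs orbT.
    by move=> /(_ (setU11 _ _)) <- _; rewrite gs.
  by exists z => //; have := sub z zs'; rewrite Es mem_cat => ->; rewrite orbT.
(* A first half and a second half meet only in [S]: otherwise the start of the one and the rest of
   the other form a path without the edge that misses [S]. *)
have meet i j v : v \in F i -> v \in F' j ->
    v \in S /\ exists a b, chain e' a (F i) v /\ chain e' v (F' j) b.
  move=> vi vj; have [a [p [c us aA pX tr]]] := cF i; have [q [b [c' us' qY bB tr']]] := cF' j.
  have [s1 [s2 [Es c1 c2]]] := chain_prefix c vi.
  have [t1 [t2 [Et d1 d2]]] := chain_prefix c' vj.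
  case: (boolP (v \in S)) => vS.
    split=> //; exists a, b.
    have [_ /(_ (setU1r _ vS)) vp] := tr v vi; have [/(_ (setU1r _ vS)) vq _] := tr' v vj.
    by split; [rewrite vp|rewrite vq].
  have [z] : exists2 z, z \in s1 ++ v :: t2 & z \in S.
    by apply: sepS aA bB; rewrite chain_split c1.
  rewrite -cat_rcons mem_cat => /orP[zs|zt] zS.
    have zF : z \in F i by rewrite Es -cat_rcons mem_cat zs.
    have [_ /(_ (setU1r _ zS)) zp] := tr z zF.
    suff vp : v = p by case/negP: vS; rewrite vp -zp.
    move: zs us (chain_last c2); rewrite zp Es -cat_rcons cat_uniq inE.
    by move=> zs /and3P[_ /hasPn nh _] /orP[/eqP//|/nh]; rewrite /= zs.
  have zF : z \in F' j by rewrite Et mem_cat inE zt !orbT.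
  have [/(_ (setU1r _ zS)) zp _] := tr' z zF.
  suff vq : v = q by case/negP: vS; rewrite vq -zp.
  move: zt us' (chain_head d1); rewrite zp Et mem_rcons inE cat_uniq.
  move=> zt /and3P[_ /hasPn nh _] /orP[/eqP//|qt].
  by have /nh := mem_behead (s := v :: t2) zt; rewrite /= qt.
(* Halves are joined at a common vertex of [S], or across the edge from [x] to [y]. *)
pose matched i j := exists a v w b, [/\ link e' A (x |: S) a (F i) v,
  link e' (y |: S) B w (F' j) b & (v = w /\ v \in S) \/ (v = x /\ w = y)].
have [J matchJ] : exists J : 'I_k -> 'I_k, forall i, matched i (J i).
  apply: functional_choice => i; have [a [v l]] := cF i.
  have [_ _ _ + _] := l; rewrite !inE => /orP[/eqP vx|vS].
    have [j [b l']] := link_start_bij (conj cF' dF') cy (setU11 y S).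
    by exists j, a, v, y, b; split=> //; right.
  have [j [b l']] := link_start_bij (conj cF' dF') cy (setU1r y vS).
  by exists j, a, v, v, b; split=> //; left.
have J_inj : injective J.
  move=> i i'; have [a [v [w [b [l1 l2 H]]]]] := matchJ i.
  have [a' [v' [w' [b' [l1' l2' H']]]]] := matchJ i' => E.
  have ww : w = w'.
    have [c2 _ wY _ _] := l2; have [_ _ _ _ t] := l2'.
    by move: (chain_head c2); rewrite E => /t[/(_ wY)].
  have vv : v = v'.
    case: H H' => [[vw vS]|[vx wy]] [[vw' vS']|[vx' wy']].
    - by rewrite vw ww.
    - by case/negP: yS; rewrite -wy' -ww -vw.
    - by case/negP: yS; rewrite -wy ww -vw'.
    - by rewrite vx.
  have [c1 _ _ _ _] := l1; have [c1' _ _ _ _] := l1'.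
  by apply: (dF i i' v); rewrite ?(chain_last c1) // vv (chain_last c1').
have /functional_choice[G HG] : forall i, exists s : seq V,
    (exists a b, [/\ chain e a s b, a \in A & b \in B]) /\
    forall z, z \in s -> z \in F i \/ z \in F' (J i).
  move=> i; have [a [v [w [b [l1 l2 H]]]]] := matchJ i.
  have [c1 _ aA _ _] := l1; have [c2 _ _ bB _] := l2.
  have {}c1 := chain_mono (fun _ _ _ _ => @e'e _ _) c1.
  have {}c2 := chain_mono (fun _ _ _ _ => @e'e _ _) c2.
  case: H => [[vw _]|[vx wy]]; last first.
    exists (F i ++ F' (J i)); split; last by move=> z; rewrite mem_cat => /orP.
    by exists a, b; split=> //; apply: chain_cat c1 _ c2; rewrite vx wy.
  subst w; case: (F' (J i)) c2 (chain_head c2) => [//|v' t] c2 _.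
  have Ev := chain_headE c2; subst v'.
  case/lastP: (F i) c1 => [//|s v'] c1; have Ev := chain_lastE c1; subst v'.
  exists (s ++ v :: t); split.
    by exists a, b; split=> //; rewrite chain_split c1.
  move=> z; rewrite -cat_rcons mem_cat => /orP[|zt]; first by left.
  by right; rewrite inE zt orbT.
have [F'' [lF _]] : exists F'', linkage e A B F'' /\ forall i, {subset F'' i <= G i}.
  apply: trim_family => [i|]; first by case: (HG i).
  (* By [meet] such a vertex lies in [S]; there the second half of path [j] starts and its first
     half ends, so disjointness of the first halves applies. *)
  have mixed i j z : z \in F i -> z \in F' (J j) -> i = j.
    move=> zi zj; have [zS [a [b [c1 c2]]]] := meet _ _ _ zi zj.
    have [a' [v [w [b' [l1 l2 H]]]]] := matchJ j.
    have zw : z = w.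
      by have [_ _ _ _ t] := l2; have [/(_ (setU1r y zS))] := t z zj.
    have vz : v = z.
      by case: H => [[-> _]//|[_ wy]]; case/negP: yS; rewrite -wy -zw.
    by apply: (dF i j z) => //; rewrite -vz; have [/chain_last] := l1.
  move=> i j z /(proj2 (HG i))[zi|zi] /(proj2 (HG j))[zj|zj].
  - exact: dF zi zj.
  - exact: mixed zi zj.
  - by apply/esym; apply: mixed zj zi.
  - by apply: J_inj; apply: dF' zi zj.
by exists F''.
Qed.

End Menger.

(** * Longest cycles and successors of attachments *)

Lemma uniq_cat_disjoint (T : eqType) (s1 s2 : seq T) :
  uniq s1 -> uniq s2 -> (forall z, z \in s1 -> z \in s2 -> False) -> uniq (s1 ++ s2).
Proof.
move=> u1 u2 H; rewrite cat_uniq u1 u2 andbT /=.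
by apply/hasPn => z z2; apply/negP => z1; apply: H z1 z2.
Qed.

Section LongestCycle.

Variables (V : finType) (adj : rel V).
Hypothesis adj_sym : symmetric adj.

Definition cycle_bound (A : pred V) (c : nat) :=
  forall s, cycle adj s -> uniq s -> {subset s <= A} -> size s <= c.

Variables (u : nat -> V) (c : nat).
Hypotheses (uc : cyclic_walk adj u c) (maxc : cycle_bound predT c).

Definition off (s : seq V) := forall z, z \in s -> z \notin warc u 0 c.

Lemma off_warc s i n z : off s -> z \in s -> z \in warc u i n -> False.
Proof.
move=> offs /offs /negP zC /mem_warc[t _ E]; apply: zC.
by apply/(mem_warc_full uc); exists t.
Qed.

(** Putting [d] in place of the l - 1 vertices strictly between u_a and u_(a+l) gives a cycle again.
    The case l = c is a detour that returns to the same vertex of C. *)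
Lemma insertion a l d x y : 0 < l <= c -> chain adj x d y -> uniq d -> off d ->
  adj (u a) x -> adj y (u (a + l)) -> size d < l.
Proof.
move=> /andP[l0 lc] cd ud offd ax yb.
have ca := chain_warc uc (a + l) (n := c - l) ltac:(lia).
rewrite (_ : a + l + (c - l) = a + c) ?(cw_period uc) in ca; last by lia.
have cyc := chain_cycle (chain_cat cd yb ca) ax.
have := maxc cyc; rewrite size_cat size_warc => H.
suff : size d + (c - l).+1 <= c by lia.
apply: H => //; apply: uniq_cat_disjoint => //; first by apply: (uniq_warc uc); lia.
by move=> z; apply: off_warc.
Qed.

(* The cycle u_(a+1) ... u_b, y ... x, u_a ... u_g (backwards), u_(b+1) ... u_f
   omits only the vertices strictly between u_f and u_g. *)
Lemma crossing a b f g d x y : a < b -> b < f -> f < g -> g <= a + c ->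
  chain adj x d y -> uniq d -> off d -> adj (u a) x -> adj y (u b) ->
  adj (u a.+1) (u f) -> adj (u b.+1) (u g) -> size d < g - f.
Proof.
move=> ab bf fg gac cd ud offd ax yb af bg.
have c1 := chain_warc uc a.+1 (n := b - a.+1) ltac:(lia).
rewrite (_ : a.+1 + (b - a.+1) = b) in c1; last by lia.
have c2 := chain_warc uc b.+1 (n := f - b.+1) ltac:(lia).
rewrite (_ : b.+1 + (f - b.+1) = f) in c2; last by lia.
have c3 := chain_warc uc g (n := a + c - g) ltac:(lia).
rewrite (_ : g + (a + c - g) = a + c) ?(cw_period uc) in c3; last by lia.
have yb' : adj (u b) y by rewrite adj_sym.
have ax' : adj x (u a) by rewrite adj_sym.
have bg' : adj (u g) (u b.+1) by rewrite adj_sym.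
have af' : adj (u f) (u a.+1) by rewrite adj_sym.
have cyc := chain_cycle (chain_cat (chain_cat (chain_cat c1 yb' (chain_rev adj_sym cd)) ax'
  (chain_rev adj_sym c3)) bg' c2) af'.
set A1 := warc _ _ _ in cyc; set A3 := warc _ g _ in cyc; set A2 := warc _ b.+1 _ in cyc.
have perm : perm_eq (((A1 ++ rev d) ++ rev A3) ++ A2) (d ++ (A1 ++ A2 ++ A3)).
  apply/permP => P; rewrite !count_cat !count_rev.
  by move: (count P d) (count P A1) (count P A2) (count P A3); clear; lia.
have := maxc cyc; rewrite (perm_size perm) (perm_uniq perm).
have sz : size (d ++ A1 ++ A2 ++ A3) = size d + c + f.+1 - g.
  by rewrite !size_cat !size_warc; clear - ab bf fg gac; lia.
rewrite sz => H; suff : size d + c + f.+1 - g <= c by clear - ab bf fg gac; lia.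
apply: H => //; apply: uniq_cat_disjoint => //.
  have : uniq (warc u a.+1 c) by apply: (uniq_warc uc).
  apply: subseq_uniq.
  have -> : c = (b - a.+1).+1 + ((f - b.+1).+1 + (g - f.+1 + (a + c - g).+1)).
    by clear - ab bf fg gac; lia.
  rewrite !warcD.
  rewrite (_ : a.+1 + (b - a.+1).+1 = b.+1); last by clear - ab bf fg gac; lia.
  rewrite (_ : b.+1 + (f - b.+1).+1 = f.+1); last by clear - ab bf fg gac; lia.
  rewrite (_ : f.+1 + (g - f.+1) = g); last by clear - ab bf fg gac; lia.
  apply: cat_subseq => //; apply: cat_subseq => //.
  by rewrite -/A3; apply: suffix_subseq.
move=> z zd; rewrite !mem_cat => /or3P[]; exact: off_warc zd.
Qed.

(** The cycle u_(a+1) ... u_b, y ... x, u_a ... u_(b+1) (backwards), o would contain all of C and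
    more. *)
Lemma no_common_neighbor a b d x y o : a < b -> b < a + c ->
  chain adj x d y -> uniq d -> off d -> adj (u a) x -> adj y (u b) ->
  o \notin warc u 0 c -> o \notin d ->
  adj (u a.+1) o -> adj (u b.+1) o -> False.
Proof.
move=> ab bac cd ud offd ax yb oC od ao bo.
have c1 := chain_warc uc a.+1 (n := b - a.+1) ltac:(lia).
rewrite (_ : a.+1 + (b - a.+1) = b) in c1; last by lia.
have c3 := chain_warc uc b.+1 (n := a + c - b.+1) ltac:(lia).
rewrite (_ : b.+1 + (a + c - b.+1) = a + c) ?(cw_period uc) in c3; last by lia.
have yb' : adj (u b) y by rewrite adj_sym.
have ax' : adj x (u a) by rewrite adj_sym.
have ao' : adj o (u a.+1) by rewrite adj_sym.
have cyc := chain_cycle (chain_rcons (chain_cat (chain_cat c1 yb' (chain_rev adj_sym cd)) ax'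
  (chain_rev adj_sym c3)) bo) ao'.
set A1 := warc _ _ _ in cyc; set A3 := warc _ b.+1 _ in cyc.
have perm : perm_eq (rcons ((A1 ++ rev d) ++ rev A3) o) ((o :: d) ++ (A1 ++ A3)).
  apply/permP => P; rewrite -cats1 !count_cat !count_rev /=.
  by move: (count P d) (count P A1) (count P A3) (P o : nat); clear; lia.
have := maxc cyc; rewrite (perm_size perm) (perm_uniq perm).
have sz : size ((o :: d) ++ A1 ++ A3) = (size d + c).+1.
  by rewrite !size_cat !size_warc /=; clear - ab bac; lia.
rewrite sz => H; suff : (size d + c).+1 <= c by clear; lia.
apply: H => //; apply: uniq_cat_disjoint; first by rewrite /= od ud.
  have : uniq (warc u a.+1 c) by apply: (uniq_warc uc).
  apply: subseq_uniq.
  have -> : c = (b - a.+1).+1 + (a + c - b.+1).+1 by clear - ab bac; lia.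
  rewrite !warcD.
  by rewrite (_ : a.+1 + (b - a.+1).+1 = b.+1); last by clear - ab; lia.
have offo : off (o :: d) by move=> z; rewrite inE => /orP[/eqP->|/offd].
move=> z zd; rewrite !mem_cat => /orP[]; exact: off_warc zd.
Qed.

End LongestCycle.

Lemma seq_min (s : seq nat) : s != [::] -> exists2 p, p \in s & {in s, forall q, p <= q}.
Proof.
elim: s => // a [_ _|b s /(_ isT)[p ps minp] _].
  by exists a => [|q]; rewrite inE // => /eqP->.
case: (leqP a p) => ap.
  by exists a; rewrite ?mem_head // => q; rewrite inE => /orP[/eqP->//|/minp]; apply: leq_trans.
exists p; first by rewrite inE ps orbT.
by move=> q; rewrite inE => /orP[/eqP->|/minp//]; apply: ltnW.
Qed.

Lemma seq_max (s : seq nat) : s != [::] -> exists2 p, p \in s & {in s, forall q, q <= p}.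
Proof.
elim: s => // a [_ _|b s /(_ isT)[p ps minp] _].
  by exists a => [|q]; rewrite inE // => /eqP->.
case: (leqP p a) => ap.
  by exists a; rewrite ?mem_head // => q; rewrite inE => /orP[/eqP->//|/minp H]; apply: leq_trans ap.
exists p; first by rewrite inE ps orbT.
by move=> q; rewrite inE => /orP[/eqP->|/minp//]; apply: ltnW.
Qed.

(** * Degrees of the successors towards the cycle *)

Section Attachments.

Variables (V : finType) (adj : rel V).
Hypotheses (adj_sym : symmetric adj) (adj_irr : irreflexive adj).
Variables (u : nat -> V) (c : nat).
Hypotheses (uc : cyclic_walk adj u c) (maxc : cycle_bound adj predT c).

Definition bypass (p q l : nat) := exists d x y,
  [/\ chain adj x d y, uniq d, off u c d, adj (u p) x & adj y (u q) /\ l <= size d].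

Definition succ_nbrs (att : seq nat) z := count (fun p => adj (u p.+1) (u z)) att.

Section Segment.

Variables (att : seq nat) (a b : nat).
Hypotheses (u_att : uniq att) (t_gt1 : 1 < size att) (ltba : b < a).
Hypotheses (att_ge : {in att, forall p, a <= p <= b + c}) (b_att : b + c \in att).
Hypothesis byp : {in att &, forall p q, p < q -> bypass p q (size att).-1}.

(** Think of [b] and [a] as consecutive attachments, [att] listing one full turn of them inside
    [a, b + c]. Then p < q < z + c < z' + c <= p + c, and [crossing] bounds the bypass between p and
    q by z' - z. *)
Let gap p q z z' : p \in att -> q \in att -> p < q -> b < z -> z < z' -> z' <= a ->
  adj (u p.+1) (u z) -> adj (u q.+1) (u z') -> size att <= z' - z.
Proof.
move=> pa qa pq bz zz' z'a pz qz'.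
have [d [x [y [cd ud offd px [yq sz]]]]] := byp pa qa pq.
have := crossing adj_sym uc maxc pq (f := z + c) (g := z' + c) _ _ _ cd ud offd px yq.
rewrite !(cw_period uc) => /(_ _ _ _ pz qz').
have := att_ge pa; have := att_ge qa.
clear -sz t_gt1 zz' bz z'a; move=> H1 H2 H; have : size d < z' + c - (z + c) by apply: H; lia.
lia.
Qed.

(** Position b + 1 is the successor of [b] itself. Were it adjacent to another successor, [crossing]
    with the cycle edge u_(b+1) u_(b+2) as second chord would omit no vertex at all. *)
Let first0 : succ_nbrs att b.+1 = 0.
Proof.
apply/eqP; rewrite /succ_nbrs -leqn0 leqNgt -has_count; apply/hasPn => p pa /=; apply/negP => pb.
have [E|pb'] := eqVneq p (b + c).
  by move: pb; rewrite E -addSn (cw_period uc) adj_irr.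
have pbc : p < b + c by have := att_ge pa; clear -pb'; lia.
have [d [x [y [cd ud offd px [yq sz]]]]] := byp pa b_att pbc.
have c1 : 1 < c by have := att_ge pa; clear -pbc ltba; lia.
(* Otherwise [b] and [p] are neighbours on C and the bypass could be inserted between them. *)
have bp : b.+2 <= p.
  have /andP[ap _] := att_ge pa; rewrite ltnNge; apply/negP => pb1.
  have Ep : p = b + 1 by clear -pb1 ap ltba; lia.
  have yq' : adj (u b) y by rewrite adj_sym -(cw_period uc).
  have px' : adj x (u (b + 1)) by rewrite adj_sym -Ep.
  have := insertion uc maxc (l := 1) _ (chain_rev adj_sym cd) _ _ yq' px'.
  rewrite rev_uniq size_rev; clear -ud offd sz t_gt1 c1 => H.
  have : size d < 1 by apply: H => //; [lia|move=> z; rewrite mem_rev; apply: offd].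
  lia.
have := crossing adj_sym uc maxc pbc (f := b.+1 + c) (g := b.+2 + c) _ _ _ cd ud offd px yq.
rewrite !(cw_period uc) => /(_ _ _ _ pb).
move=> H.
have : size d < b.+2 + c - (b.+1 + c).
  by apply: H; rewrite ?(cw_adj uc) //; clear -bp; lia.
clear -sz t_gt1; lia.
Qed.

Let T p := count (leq p) att.

(** [T p] counts the attachments from [p] on, so [p, q] contains T p - T q + 1 of them. *)
Lemma succ_nbrs_range p q z : q \in att -> {in att, forall r, adj (u r.+1) (u z) -> p <= r <= q} ->
  p <= q -> succ_nbrs att z + T q <= (T p).+1.
Proof.
move=> qa H pq.
have -> : T p = count [pred r | p <= r <= q] att + count (ltn q) att.
  rewrite /T -count_predUI.
  rewrite [X in _ = _ + X](_ : _ = 0) ?addn0.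
    by apply: eq_count => r /=; lia.
  by apply/eqP; rewrite -leqn0 leqNgt -has_count; apply/hasPn => r _ /=; lia.
have -> : T q = (count (ltn q) att).+1.
  have E1 : count_mem q att = 1 by rewrite count_uniq_mem // qa.
  rewrite -add1n -E1 -count_predUI [X in _ = _ + X](_ : _ = 0) ?addn0.
    by apply: eq_count => r /=; lia.
  by apply/eqP; rewrite -leqn0 leqNgt -has_count; apply/hasPn => r _ /=; lia.
rewrite addnS ltnS leq_add2r /succ_nbrs.
have E : {in att, (fun p => adj (u p.+1) (u z)) =1 predI (fun p => adj (u p.+1) (u z)) [pred r | p <= r <= q]}.
  by move=> r ra /=; case: (boolP (adj _ _)) => //= /(H r ra) ->.
rewrite (eq_in_count E); apply: sub_count => r /= /andP[] //.
Qed.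

(* Along the segment, the attachments p with u_(p+1) adjacent to u_z move
   backwards, so that the counts telescope through T; they move forwards only
   after a stretch of length size att (see gap), which pays for it. *)
Lemma segment_bound : \sum_(b.+1 <= z < a.+1) succ_nbrs att z + 2 <= a - b + size att.
Proof.
have Tle p : T p <= size att by apply: count_size.
(* Either nothing has been counted yet, or [z] is the last position with a nonzero count and [p] its
   least attachment. At the end [T p] is at most the number of attachments. *)
suff H n : n < a - b -> \sum_(b.+1 <= z < (b + n).+2) succ_nbrs att z = 0 \/
    exists z p, [/\ b < z <= b + n.+1, p \in att,
     {in att, forall r, adj (u r.+1) (u z) -> p <= r}, adj (u p.+1) (u z) &
     \sum_(b.+1 <= y < (b + n).+2) succ_nbrs att y + b + 2 <= z + T p].
  have := H (a - b).-1; rewrite (_ : (b + (a - b).-1).+2 = a.+1); last by clear -ltba; lia.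
  case=> [|->|[z [p [zb pa _ _ S]]]]; [by clear -ltba; lia|by clear -t_gt1; lia|].
  have := Tle p; clear -S zb ltba; lia.
elim: n => [_|n IH na].
  by left; rewrite addn0 big_nat1 first0.
rewrite addnS big_nat_recr /=; last by clear; lia.
move: {IH}(IH (ltnW na)); set z' := (b + n).+2 => IH.
have Ez : z' = (b + n).+2 by []; clearbody z'.
case: (posnP (succ_nbrs att z')) => [->|Jz'].
  rewrite addn0; case: IH => [?|[z [p [zb pa mp pz S]]]]; [by left|right].
  by exists z, p; split=> //; clear -zb Ez; lia.
right; pose s := [seq p <- att | adj (u p.+1) (u z')].
have s0 : s != [::] by rewrite -size_eq0 size_filter -lt0n.
have [p' p's minp'] := seq_min s0; have [q qs maxq] := seq_max s0.
move: p's qs; rewrite !mem_filter => /andP[p'z' p'a] /andP[qz' qa].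
have R : succ_nbrs att z' + T q <= (T p').+1.
  apply: succ_nbrs_range => //; last by apply: minp'; rewrite mem_filter qz'.
  by move=> r ra rz'; rewrite minp' ?maxq ?mem_filter ?rz'.
have Tq : 0 < T q by rewrite -has_count; apply/hasP; exists q => /=.
exists z', p'; split=> //; first by clear -Ez; lia.
  by move=> r ra rz'; apply: minp'; rewrite mem_filter rz'.
case: IH => [->|[z [p [zb pa mp pz S]]]].
  by clear -R Tq Ez; lia.
have zz' : z < z' by clear -zb Ez; lia.
suff : T p + z < T q + z' by clear -R S; lia.
case: (leqP q p) => [qp|pq].
  have : T p <= T q by apply: sub_count => r /= ; apply: leq_trans qp.
  by clear -zz'; lia.
have := gap pa qa pq _ zz' _ pz qz'.
have H1 : b < z by clear -zb; lia.
have H2 : z' <= a by clear -na Ez; lia.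
by move=> /(_ H1 H2); have := Tle p; clear -Tq zz'; lia.
Qed.

End Segment.

End Attachments.

Lemma increasing_of_step (A : nat -> nat) i j : (forall m, A m < A m.+1) -> i < j -> A i < A j.
Proof.
move=> stepA; elim: j => // j IH; rewrite ltnS leq_eqVlt => /orP[/eqP->|/IH H]; first exact: stepA.
exact: ltn_trans H (stepA j).
Qed.

Lemma card_set_count (T : finType) (s : seq T) (P : pred T) :
  uniq s -> #|[set y | P y] :&: [set y in s]| = count P s.
Proof.
move=> us; rewrite -size_filter -(card_uniqP (filter_uniq P us)).
by apply: eq_card => y; rewrite !inE mem_filter.
Qed.

Section SuccessorSum.

Variables (V : finType) (adj : rel V).
Hypotheses (adj_sym : symmetric adj) (adj_irr : irreflexive adj).
Variables (u : nat -> V) (c : nat).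
Hypotheses (uc : cyclic_walk adj u c) (maxc : cycle_bound adj predT c).
Variables (A : nat -> nat) (t : nat).
Hypotheses (t_gt1 : 1 < t) (stepA : forall m, A m < A m.+1) (perA : forall m, A (m + t) = A m + c).
Hypothesis byp : forall i j, i < j -> j < i + t -> bypass adj u c (A i) (A j) t.-1.

Let att m := [seq A i | i <- iota m t].

Let A_inj : injective A.
Proof.
move=> i j E; case: (ltngtP i j) => // /(increasing_of_step stepA); rewrite E ltnn //.
Qed.

Let J z := succ_nbrs adj u (att 0) z.

(** Each shift replaces [A m] by [A m + c], the same vertex of the cycle. *)
Lemma succ_nbrs_shift m z : succ_nbrs adj u (att m) z = J z.
Proof.
rewrite /J; elim: m => // m <-; rewrite /succ_nbrs /att !count_map.
have [t' Et] : exists t', t = t'.+1 by exists t.-1; rewrite prednK // ltnW.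
have -> : iota m.+1 t = iota m.+1 t' ++ [:: m + t].
  by rewrite {1}Et -[t'.+1]addn1 iotaD /= addSnnS -Et.
rewrite {2}Et /= count_cat /= addn0 addnC; congr (_ + _).
by rewrite perA -addSn (cw_period uc).
Qed.

Lemma segment_sum m : \sum_((A m).+1 <= z < (A m.+1).+1) J z + 2 <= A m.+1 - A m + t.
Proof.
have sz : size (att m.+1) = t by rewrite size_map size_iota.
under eq_bigr => z _ do rewrite -(succ_nbrs_shift m.+1).
rewrite -[in leqRHS]sz; apply: (segment_bound adj_sym adj_irr uc maxc) => //.
- by rewrite map_inj_uniq ?iota_uniq.
- by rewrite sz.
- move=> p /mapP[i]; rewrite mem_iota => /andP[mi im] ->; rewrite -perA.
  apply/andP; split.
    by move: mi; rewrite leq_eqVlt => /orP[/eqP->|/(increasing_of_step stepA)/ltnW].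
  move: im; rewrite addSn ltnS leq_eqVlt => /orP[/eqP->|/(increasing_of_step stepA)/ltnW] //.
- rewrite -perA; apply: map_f; rewrite mem_iota; clear -t_gt1; lia.
move=> p q /mapP[i + ->] /mapP[j + ->]; rewrite !mem_iota sz => mi mj Aij.
have ij : i < j.
  case: (ltngtP i j) => // [/(increasing_of_step stepA)|E]; first by clear -Aij; lia.
  by move: Aij; rewrite E ltnn.
apply: byp => //; clear -ij mi mj; lia.
Qed.

(** The [t] segments between consecutive attachments make up one turn, and each contributes at most
    its length plus t - 2. *)
Lemma circuit_sum : \sum_((A 0).+1 <= z < (A 0 + c).+1) J z + t * 2 <= c + t * t.
Proof.
have mono i j : i <= j -> A i <= A j.
  by rewrite leq_eqVlt => /orP[/eqP->|/(increasing_of_step stepA)/ltnW].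
have H n : \sum_((A 0).+1 <= z < (A n).+1) J z + n * 2 <= A n - A 0 + n * t.
  elim: n => [|n IH]; first by rewrite big_geq.
  rewrite (@big_cat_nat _ _ _ (A n).+1) //=; [|by rewrite ltnS mono..].
  have := segment_sum n; have := mono 0 n isT; have := stepA n; move: IH.
  by rewrite !mulSn; clear; lia.
by have := H t; rewrite -{1 2}[t]add0n perA addKn.
Qed.

(** Outside C a vertex of [D] sees no successor and any other vertex at most one, so the degrees
    there add up to at most |V| - c - |D|. The degrees on C are counted by [circuit_sum]. *)
Lemma successor_degree_sum (D : {set V}) d : (forall x, d <= #|[set y | adj x y]|) ->
  (forall z, z \in D -> z \notin warc u 0 c) ->
  (forall i z, i < t -> z \in D -> ~~ adj (u (A i).+1) z) ->
  (forall i j o, i < j -> j < t -> o \notin warc u 0 c ->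
     adj (u (A i).+1) o -> adj (u (A j).+1) o -> False) ->
  t * d + #|D| + t * 2 <= #|V| + t * t.
Proof.
move=> dmin DC DN common.
pose C := [set y in warc u (A 0).+1 c].
have inC z : (z \in C) = (z \in warc u 0 c).
  by rewrite inE; apply/(mem_warc_full uc)/(mem_warc_full uc).
pose O := ~: (C :|: D).
pose N i := [set y | adj (u (A i).+1) y].
have NE i : i < t -> #|N i| = #|N i :&: C| + #|N i :&: O|.
  move=> it; rewrite -(cardsID C (N i)); congr (_ + _); apply: eq_card => y.
  rewrite !inE; case: (boolP (y \in D)) => yD; last by rewrite orbF andbC.
  by rewrite orbT /= andbF; apply/negP => /andP[_]; apply/negP; apply: DN.
have sumC : \sum_(i < t) #|N i :&: C| = \sum_((A 0).+1 <= z < (A 0 + c).+1) J z.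
  rewrite (eq_bigr (fun i : 'I_t => \sum_((A 0).+1 <= z < (A 0 + c).+1) adj (u (A i).+1) (u z))); last first.
    move=> i _; rewrite card_set_count; last exact: (uniq_warc uc).
    rewrite /warc count_map -sum1_count big_mkcond /= /index_iota.
    have -> : (A 0 + c).+1 - (A 0).+1 = c by clear; lia.
    by apply: eq_bigr => z _ /=; case: (adj _ _).
  rewrite exchange_big /=; apply: eq_bigr => z _.
  rewrite /J /succ_nbrs /att count_map -sum1_count [RHS]big_mkcond /=.
  rewrite -(big_mkord predT (fun i => nat_of_bool (adj (u (A i).+1) (u z)))) /= /index_iota subn0.
  by apply: eq_big => // i _ /=; case: (adj _ _).
have sumO : \sum_(i < t) #|N i :&: O| <= #|O|.
  rewrite (eq_bigr (fun i : 'I_t => \sum_(y in O) (y \in N i))); last first.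
    move=> i _; rewrite -sum1_card big_mkcond [RHS]big_mkcond /=.
    by apply: eq_bigr => y _; rewrite in_setI andbC; case: (y \in O) => //=; case: (y \in N i).
  rewrite exchange_big /= -sum1_card; apply: leq_sum => y; rewrite !inE negb_or => /andP[yC _].
  case: (pickP [pred i : 'I_t | adj (u (A i).+1) y]) => [i /= iy|none]; last first.
    by rewrite big1 // => i _; rewrite inE; have /= -> := none i.
  rewrite (bigD1 i) //= big1 ?inE ?iy // => j ji; rewrite inE.
  case: (boolP (adj (u (A j).+1) y)) => // jy; exfalso.
  have yC' : y \notin warc u 0 c by rewrite -inC inE.
  case: (ltngtP i j) => ij; [exact: common ij (ltn_ord j) yC' iy jy|exact: common ij (ltn_ord i) yC' jy iy|].
  by case/eqP: ji; apply: val_inj.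
have sumN : t * d <= \sum_(i < t) #|N i|.
  by rewrite -[t in t * d]card_ord -sum_nat_const; apply: leq_sum => i _; apply: dmin.
have cardC : #|C| = c.
  rewrite -[RHS](size_warc u (A 0).+1) -(card_uniqP (uniq_warc uc _ (leqnn c))).
  by apply: eq_card => y; rewrite inE.
have cardV : c + #|D| + #|O| = #|V|.
  rewrite -cardC -(cardsC (C :|: D)) cardsU (_ : C :&: D = set0) ?cards0 ?subn0 //.
  apply/setP => y; rewrite !in_setI in_set0 inC; apply/negP => /andP[yC] /DC.
  by rewrite yC.
rewrite (eq_bigr (fun i : 'I_t => #|N i :&: C| + #|N i :&: O|)) in sumN; last by move=> i _; apply: NE.
rewrite big_split /= sumC in sumN.
have {}sumN := leq_trans sumN (leq_add (leqnn _) sumO).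
move: circuit_sum sumN cardV; move: (\sum_(_ <= _ < _) _) => S.
by clear; move: (t * t) (t * d) => t2 td; lia.
Qed.

End SuccessorSum.

(** * Degrees towards a longest cycle *)

(** Add the hypothesis over consecutive points of the support around the circle: each value is
    counted twice and the gaps add up to c. The pair (0, c) is one point taken twice; a support with
    only that point is covered by f 0 <= K c. *)
Lemma gap_sum (f : nat -> nat) c K : f c = f 0 -> 0 < f 0 -> 0 < c ->
  (forall a b, a < b -> b <= c -> ~~ ((a == 0) && (b == c)) -> 0 < f a -> 0 < f b ->
     f a + f b <= 2 * K * (b - a)) ->
  f 0 <= K * c -> \sum_(0 <= a < c) f a <= K * c.
Proof.
move=> fc f0 c0 H f0K.
suff S b : b < c -> exists a, [/\ a <= b, 0 < f a &
    2 * \sum_(0 <= i < b.+1) f i <= f 0 + f a + 2 * K * a].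
  have [a [ac fa Sa]] : exists a, [/\ a <= c.-1, 0 < f a &
    2 * \sum_(0 <= i < c) f i <= f 0 + f a + 2 * K * a].
    by have := S c.-1; rewrite prednK // => /(_ (leqnn _)).
  case: (posnP a) => [a0|a0].
    by move: Sa; rewrite a0 muln0 addn0; clear -f0K; lia.
  have := H a c; rewrite fc mulnBr.
  have : 2 * K * a <= 2 * K * c by rewrite leq_mul2l; clear -ac c0; lia.
  have ltac : a < c by clear -ac c0; lia.
  move=> le /(_ ltac (leqnn _)); rewrite (negPf (lt0n_neq0 a0)) => /(_ isT fa f0).
  by move: Sa le; rewrite -!mulnA; move: (K * a) (K * c) => x y; clear; lia.
elim: b => [_|b IH bc].
  exists 0; split=> //; rewrite big_nat1; clear; lia.
have [a [ab fa Sa]] := IH (ltnW bc).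
rewrite big_nat_recr //=; case: (posnP (f b.+1)) => [->|fb].
  by exists a; rewrite addn0; split=> //; apply: leqW.
exists b.+1; split=> //; rewrite ?leqnn //.
have := H a b.+1; rewrite mulnBr.
have : 2 * K * a <= 2 * K * b.+1 by rewrite leq_mul2l; clear -ab; lia.
have ltab : a < b.+1 by clear -ab; lia.
move=> le /(_ ltab (ltnW bc)); rewrite (ltn_eqF bc) andbF => /(_ isT fa fb).
by move: Sa le; rewrite mulnDr -!mulnA; move: (K * a) (K * _) => x y; clear; lia.
Qed.

Section CyclicOrdinals.

Variable h : nat.
Implicit Types (i j : 'I_h) (X Y : {set 'I_h}).

(** The number of steps forward from [i] to [j] around a cycle of length [h]; it is not
    symmetric. *)
Definition cdist i j := (j + h - i) %% h.

Lemma cdist_lt i j : cdist i j < h.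
Proof. by rewrite ltn_pmod //; case: i => /= m; apply: leq_ltn_trans. Qed.

Lemma cdistE i j : cdist i j = if i <= j then j - i else j + h - i.
Proof.
rewrite /cdist; case: leqP => ij; have jh := ltn_ord j; have ih := ltn_ord i.
  by rewrite addnC -addnBA // addnC modnDr modn_small //; clear -jh; lia.
by rewrite modn_small //; clear -ij ih; lia.
Qed.

Lemma cdist_sym i j : i != j -> cdist i j + cdist j i = h.
Proof.
rewrite -val_eqE /= !cdistE; have := ltn_ord i; have := ltn_ord j.
by case: (leqP i j); case: (leqP j i); lia.
Qed.

Lemma cdist_gt0 i j : (0 < cdist i j) = (i != j).
Proof.
rewrite -val_eqE /= cdistE; have := ltn_ord i; have := ltn_ord j.
by case: (leqP i j); lia.
Qed.

Lemma cdist_add i j k : cdist i k <= cdist i j -> cdist k j = cdist i j - cdist i k.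
Proof.
rewrite !cdistE; have := ltn_ord i; have := ltn_ord j; have := ltn_ord k.
by case: (leqP i k); case: (leqP i j); case: (leqP k j); lia.
Qed.

Lemma cdist_ordS i j : i != ordS j -> cdist i (ordS j) = (cdist i j).+1.
Proof.
rewrite -val_eqE /= !cdistE /=; have := ltn_ord i; have := ltn_ord j => jh ih.
have [E|lt] : j.+1 = h \/ j.+1 < h by clear -jh; lia.
  by rewrite E modnn; move: ih jh E; case: (leqP i 0); case: (leqP i j); lia.
by rewrite modn_small //; move: ih jh lt; case: (leqP i j.+1); case: (leqP i j); lia.
Qed.

Lemma cdist_ordS1 i : 1 < h -> cdist i (ordS i) = 1.
Proof.
rewrite cdistE /= => h1; have ih := ltn_ord i.
have [E|lt] : i.+1 = h \/ i.+1 < h by clear -ih; lia.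
  by rewrite E modnn; case: (leqP i 0); clear -E h1; lia.
by rewrite modn_small //; case: (leqP i i.+1); clear; lia.
Qed.

Lemma cdist_surj i e : e < h -> exists k, cdist i k = e.
Proof.
have ih := ltn_ord i => eh; have h0 : 0 < h by apply: leq_ltn_trans eh.
exists (Ordinal (ltn_pmod (i + e) h0)); rewrite cdistE /=.
case: (ltnP (i + e) h) => ieh.
  by rewrite modn_small //; case: (leqP i (i + e)); clear; lia.
rewrite -(subnK ieh) modnDr modn_small; last by clear -ih eh ieh; lia.
by case: leqP; clear -ih eh ieh; lia.
Qed.

Lemma card_cdist_range i m n : n <= h -> n - m <= #|[set k | m <= cdist i k < n]|.
Proof.
move=> nh; case: (leqP n m) => mn; first by rewrite (eqP mn).
have /functional_choice[g Hg] : forall e : 'I_(n - m), exists k, cdist i k = m + e.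
  by move=> e; apply: cdist_surj; have := ltn_ord e; clear -nh; lia.
have g_inj : injective g.
  by move=> a b E; apply: ord_inj; have := Hg a; rewrite E Hg; clear; lia.
rewrite -[leqLHS]card_ord -(card_imset predT g_inj); apply: subset_leq_card.
by apply/subsetP => k /imsetP[e _ ->]; rewrite inE Hg; have := ltn_ord e; clear; lia.
Qed.

(* X and the successors of Y are disjoint, and both miss the inner part of a
   shortest gap between X and Y. *)
Lemma far_sets_card X Y i j : i != j ->
  (i \in X /\ j \in Y) \/ (i \in Y /\ j \in X) -> 1 < cdist i j ->
  (forall k l, k != l -> (k \in X /\ l \in Y) \/ (k \in Y /\ l \in X) -> cdist i j <= cdist k l) ->
  #|X| + #|Y| <= (cdist j i).+2.
Proof.
move=> ij ijXY r2 minr; set r := cdist i j in r2 minr *.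
have h1 : 1 < h by apply: ltn_trans r2 (cdist_lt _ _).
pose Y' := [set ordS y | y in Y]; pose M := [set k | 2 <= cdist i k < r].
have inner k : 0 < cdist i k -> cdist i k < r -> k \in X \/ k \in Y -> False.
  move=> k0 kr kXY; have ik : i != k by rewrite -cdist_gt0.
  have kj : k != j by apply: contraTneq kr => ->; rewrite ltnn.
  have kjd : cdist k j < r.
    by rewrite (@cdist_add i) ?(ltnW kr) //; rewrite /r in kr *; clear -k0 kr; lia.
  case: ijXY kXY => [[iX jY]|[iY jX]] [kX|kY].
  - by have := minr _ _ kj (or_introl (conj kX jY)); rewrite leqNgt kjd.
  - by have := minr _ _ ik (or_introl (conj iX kY)); rewrite leqNgt kr.
  - by have := minr _ _ ik (or_intror (conj iY kX)); rewrite leqNgt kr.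
  - by have := minr _ _ kj (or_intror (conj kY jX)); rewrite leqNgt kjd.
have XY' : [disjoint X & Y'].
  apply/pred0P => k /=; apply/negP => /andP[kX /imsetP[y yY E]].
  have yk : y != k by rewrite -cdist_gt0 E cdist_ordS1.
  have := minr _ _ yk (or_intror (conj yY kX)); rewrite E cdist_ordS1 //.
  by rewrite leqNgt r2.
have XM : [disjoint X :|: Y' & M].
  apply/pred0P => k /=; apply/negP; rewrite !inE => /andP[+ /andP[k2 kr]].
  case/orP => [kX|/imsetP[y yY E]]; first by apply: inner kr _; [apply: ltnW|left].
  have ik : i != k by rewrite -cdist_gt0 ltnW.
  rewrite E in ik k2 kr; rewrite cdist_ordS // in k2 kr.
  by apply: (inner y); [by rewrite -ltnS|by apply: ltnW|right].
have cM : r - 2 <= #|M| by apply: card_cdist_range; apply/ltnW/cdist_lt.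
have cY : #|Y'| = #|Y| by rewrite card_imset //; apply: can_inj (@ordSK h).
have := max_card [in (X :|: Y') :|: M].
rewrite -cY card_ord cardsU (_ : _ :&: M = set0) ?cards0 ?subn0; last first.
  by apply/eqP; rewrite setI_eq0.
rewrite cardsU (_ : X :&: Y' = set0) ?cards0 ?subn0; last by apply/eqP; rewrite setI_eq0.
by have := cdist_sym ij; rewrite -/r; move: cM r2; clearbody r; move: #|M| #|X| #|Y'| (cdist j i) => m x y z; clear; lia.
Qed.

(** Take the least distance from a member of one set to a different member of the other. If it is at
    least 2, [far_sets_card] gives |X| + |Y| <= l, and each weight is at most 2 K. If it is 1, the
    way back has length h - 1, so h + 1 <= l, and the total weight bounds either sum by K l. If
    there is no such pair, both sets are the same singleton. *)
Lemma weight_pair_bound (w : 'I_h -> nat) K X Y l :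
  (forall i, w i <= 2 * K) -> \sum_i w i <= K * h.+1 -> 2 <= l ->
  (exists i, i \in X) -> (exists i, i \in Y) ->
  (forall i j, i \in X -> j \in Y -> i != j -> (cdist i j).+2 <= l /\ (cdist j i).+2 <= l) ->
  \sum_(i in X) w i + \sum_(i in Y) w i <= 2 * K * l.
Proof.
move=> wK sumw l2 [x xX] [y yY] dl.
have wle (Z : {set 'I_h}) : \sum_(i in Z) w i <= 2 * K * #|Z|.
  by rewrite -sum1_card big_distrr /=; apply: leq_sum => i _; rewrite ?muln1 wK.
have wle' (Z : {set 'I_h}) : \sum_(i in Z) w i <= K * h.+1.
  by apply: leq_trans sumw; rewrite [leqRHS](bigID [in Z]) /= leq_addr.
pose P := [pred p : 'I_h * 'I_h | (p.1 != p.2) &&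
  ((p.1 \in X) && (p.2 \in Y) || (p.1 \in Y) && (p.2 \in X))].
have card_case : #|X| + #|Y| <= l -> \sum_(i in X) w i + \sum_(i in Y) w i <= 2 * K * l.
  move=> le; apply: leq_trans (leq_add (wle X) (wle Y)) _.
  by rewrite -mulnDr leq_mul2l le orbT.
case: (pickP P) => [p0 Pp0|none]; last first.
  have eqxy i j : i \in X -> j \in Y -> i = j.
    by move=> iX jY; apply/eqP; have := none (i, j); rewrite /= iX jY andbT; case: eqP.
  have XE : X \subset [set y] by apply/subsetP => i iX; rewrite inE (eqxy i y).
  have YE : Y \subset [set x] by apply/subsetP => i iY; rewrite inE -(eqxy x i).
  apply: card_case; move: (subset_leq_card XE) (subset_leq_card YE); rewrite !cards1.
  by clear -l2; lia.
case: (arg_minnP (fun p => cdist p.1 p.2) Pp0) => -[i j] /= /andP[/= ij /orP ijXY] minr.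
have ijXY' : (i \in X /\ j \in Y) \/ (i \in Y /\ j \in X) by case: ijXY => /andP[]; [left|right].
have minr' k m : k != m -> (k \in X /\ m \in Y) \/ (k \in Y /\ m \in X) -> cdist i j <= cdist k m.
  by move=> km H; apply: (minr (k, m)); rewrite /= km; case: H => -[-> ->]; rewrite ?orbT.
have lij : (cdist j i).+2 <= l.
  by case: ijXY' => -[a b]; [case: (dl i j)|case: (dl j i)]; rewrite // eq_sym.
case: (leqP 2 (cdist i j)) => r2.
  by apply: card_case; apply: leq_trans lij; apply: far_sets_card.
have lh : h.+1 <= l.
  have := cdist_sym ij; move: ij; rewrite -cdist_gt0; clear -lij r2; lia.
apply: leq_trans (leq_add (wle' X) (wle' Y)) _.
have : K * h.+1 <= K * l by rewrite leq_mul2l lh orbT.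
by rewrite -mulnA; move: (K * _) (K * _); clear; lia.
Qed.

End CyclicOrdinals.

Section WeightedAttachments.

Variables (V : finType) (adj : rel V).
Hypothesis adj_sym : symmetric adj.
Variables (u : nat -> V) (c : nat).
Hypotheses (uc : cyclic_walk adj u c) (maxc : cycle_bound adj predT c).
Variables (h : nat) (w : 'I_h -> V).
Hypothesis w_off : forall i, w i \notin warc u 0 c.
Hypothesis w_conn : forall i j, i != j -> exists d,
  [/\ chain adj (w i) d (w j), uniq d, off u c d & cdist i j < size d].

(** If tips i and j are attached at positions a < b of C, [insertion] yields cdist + 2 <= b - a in
    both directions, as [weight_pair_bound] requires, and [gap_sum] adds up. If only one position is
    attached, the total weight K (h + 1) is at most K c. *)
Lemma weighted_attachments (om : 'I_h -> nat) K :
  (forall i, om i <= 2 * K) -> \sum_i om i <= K * h.+1 -> h < c ->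
  \sum_i om i * #|[set y | adj (w i) y] :&: [set y in warc u 0 c]| <= K * c.
Proof.
move=> omK sum_om hc; have c0 : 0 < c by case: c hc.
pose X a := [set i | adj (w i) (u a)].
pose f a := \sum_(i in X a) om i.
have per a : X (a + c) = X a by apply/setP => i; rewrite !inE (cw_period uc).
have sumf r : \sum_i om i * #|[set y | adj (w i) y] :&: [set y in warc u 0 c]| =
              \sum_(0 <= a < c) f (r + a).
  rewrite /f (eq_bigr (fun a => \sum_i if i \in X (r + a) then om i else 0)); last first.
    by move=> a _; rewrite big_mkcond.
  rewrite exchange_big /=; apply: eq_bigr => i _.
  have -> : [set y in warc u 0 c] = [set y in warc u r c].
    by apply/setP => y; rewrite !inE; apply/(mem_warc_full uc)/(mem_warc_full uc).
  rewrite card_set_count ?(uniq_warc uc) // /warc count_map -sum1_count mulnC big_distrl /=.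
  rewrite big_mkcond /= /index_iota subn0 -[r in iota r]addn0 iotaDl big_map.
  by apply: eq_bigr => a _; rewrite inE /=; case: (adj _ _); rewrite ?mul1n.
(* [gap_sum] starts from a position of positive weight, so the count is rotated to such an [r]. *)
case: (classic (exists r, 0 < f r)) => [[r fr]|none]; last first.
  rewrite (sumf 0) big1_seq // => a _.
  by apply/eqP; rewrite -leqn0 leqNgt; apply/negP => fa; apply: none; exists (0 + a).
have nonempty a : 0 < f a -> exists i, i \in X a.
  rewrite /f; case: (pickP [in X a]) => [i iX _|X0]; first by exists i.
  by rewrite big1 // => i; have /= -> := X0 i.
rewrite (sumf r); apply: gap_sum => //.
- by rewrite /f per addn0.
- by rewrite addn0.
- move=> a b ab bc nab fa fb.
  have across i j d : i \in X (r + a) -> j \in X (r + b) ->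
      chain adj (w i) d (w j) -> uniq d -> off u c d -> size d < b - a.
    rewrite !inE => iX jX cd ud od.
    apply: (insertion uc maxc (a := r + a) _ cd ud od); first by clear -ab bc; lia.
      by rewrite adj_sym.
    by rewrite -addnA subnKC // ltnW.
  apply: weight_pair_bound => //; try exact: nonempty.
    have [i iX] := nonempty _ fa; have [j jX] := nonempty _ fb.
    have [E|ij] := eqVneq i j.
      apply: (across i j [:: w i] iX jX) => //; last by move=> z; rewrite inE => /eqP->.
      by rewrite E; apply: chain1.
    have [d [cd ud od sd]] := w_conn ij.
    by apply: leq_ltn_trans (across _ _ _ iX jX cd ud od); apply: leq_ltn_trans sd.
  move=> i j iX jX ij; split.
    have [d [cd ud od sd]] := w_conn ij.
    by apply: leq_ltn_trans (across _ _ _ iX jX cd ud od).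
  rewrite eq_sym in ij; have [d [cd ud od sd]] := w_conn ij.
  have := across _ _ (rev d) iX jX (chain_rev adj_sym cd).
  rewrite rev_uniq size_rev => /(_ ud) H; apply: leq_ltn_trans sd (H _).
  by move=> z; rewrite mem_rev; apply: od.
rewrite addn0; apply: leq_trans (_ : K * h.+1 <= _); last by rewrite leq_mul2l hc orbT.
by apply: leq_trans sum_om; rewrite [leqRHS](bigID [in X r]) /= leq_addr.
Qed.

End WeightedAttachments.

(** * Spokes *)

Lemma exists_max (T : Type) (P : T -> Prop) (f : T -> nat) m :
  (exists x, P x) -> (forall x, P x -> f x <= m) ->
  exists2 x, P x & forall y, P y -> f y <= f x.
Proof.
move=> [x Px] bnd; have [n] := ubnP (m - f x); elim: n x Px => // n IH x Px xn.
case: (classic (forall y, P y -> f y <= f x)) => [H|nH]; first by exists x.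
have [y Hy] := not_all_ex_not _ _ nH; have [Py /negP] := imply_to_and _ _ Hy.
rewrite -ltnNge => lt; apply: (IH y Py); have := bnd y Py.
by clear -lt xn; lia.
Qed.

Section Spokes.

Variables (V : finType) (adj : rel V).
Hypotheses (adj_sym : symmetric adj) (adj_irr : irreflexive adj).
Variables (A0 : {set V}) (u : nat -> V) (h : nat).
Hypotheses (uh : cyclic_walk adj u h) (uA : forall i, u i \in A0).
Hypothesis maxh : cycle_bound adj [in A0] h.

Implicit Types (P : 'I_h -> seq V) (i j b : 'I_h).

Definition row P i := u i :: P i.
Definition tip P i := last (u i) (P i).

Definition spokes P :=
  [/\ forall i, path adj (u i) (P i), forall i, uniq (row P i),
      forall i, {subset row P i <= A0} &
      forall i j z, z \in row P i -> z \in row P j -> i = j].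

(* The bonus for nonempty spokes lets an empty one gain by taking over the
   end of another spoke, see bare_row_nbr. *)
Definition spoke_score P := \sum_i (size (P i) + (P i != [::])).

Definition max_spokes P := spokes P /\ forall P', spokes P' -> spoke_score P' <= spoke_score P.

Lemma u_ord_inj i j : u i = u j -> i = j.
Proof. by move/(cw_inj uh (ltn_ord i) (ltn_ord j)); apply: ord_inj. Qed.

Lemma u_ordS i : u (ordS i) = u i.+1.
Proof. by rewrite /= (cw_modn uh). Qed.

Lemma exists_max_spokes : exists P, max_spokes P.
Proof.
have [||P PS maxP] := @exists_max _ spokes spoke_score (\sum_(i < h) (#|V| + 1)).
- exists (fun=> [::]); split=> // [i z|i j z]; first by rewrite inE => /eqP->.
  by rewrite !inE => /eqP-> /eqP /u_ord_inj.
- move=> P [_ uP _ _]; apply: leq_sum => i _; apply: leq_add; last by case: (P i).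
  have /card_uniqP := uP i; rewrite /= => E.
  by apply: leq_trans (leqnSn _) _; rewrite -E max_card.
by exists P.
Qed.

Definition upd P i s k := if k == i then s else P k.

Section Rows.

Variable P : 'I_h -> seq V.
Hypothesis PS : spokes P.

Lemma row_chain i : chain adj (u i) (row P i) (tip P i).
Proof. by case: PS => pP _ _ _; rewrite /= !eqxx pP. Qed.

Lemma tip_row i : tip P i \in row P i.
Proof. exact: mem_last. Qed.

Lemma u_row i b : u b \in row P i -> i = b.
Proof. by case: PS => _ _ _ dP ub; apply: dP ub (mem_head _ _). Qed.

(** The path goes down row [b] to the cycle, along it to the root of row [b'] and up that row; the
    stretch between the roots adds cdist - 1 vertices. *)
Lemma cross_rows b b' s1 t1 s2 t2 z1 z2 : b != b' ->
  row P b = s1 ++ t1 -> row P b' = s2 ++ t2 ->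
  chain adj (u b) s1 z1 -> chain adj (u b') s2 z2 ->
  exists d, [/\ chain adj z1 d z2, uniq d, {subset d <= A0},
     (size d).+1 = size s1 + size s2 + cdist b b' &
     forall z, z \in d -> [\/ z \in s1, z \in s2 | exists t : 'I_h, [/\ z = u t, t != b & t != b']]].
Proof.
move=> bb' E1 E2 c1 c2; have [_ uP sP dP] := PS.
have k0 : 0 < cdist b b' by rewrite cdist_gt0.
have kh := cdist_lt b b'.
have s1P : {subset s1 <= row P b} by move=> z; rewrite E1 mem_cat => ->.
have s2P : {subset s2 <= row P b'} by move=> z; rewrite E2 mem_cat => ->.
have Eb' : u b' = u (b + cdist b b').
  apply/eqP; rewrite (cw_eq uh) /cdist modnDmr subnKC; last by have := ltn_ord b; clear; lia.
  by rewrite modnDr.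
pose k := (cdist b b').-1; pose inner := warc u b.+1 k.
have innerE z : z \in inner -> exists t : 'I_h, [/\ z = u t, t != b & t != b'].
  case/mem_warc => e; rewrite /k => he ->.
  have [t Ht] : exists t, cdist b t = e - b by apply: cdist_surj; clear -he kh; lia.
  exists t; split.
  - apply/eqP; rewrite (cw_eq uh); apply/eqP.
    have -> : e = b + cdist b t by rewrite Ht; clear -he; lia.
    rewrite /cdist modnDmr subnKC ?modnDr //; have := ltn_ord b; clear; lia.
  - by rewrite eq_sym -cdist_gt0 Ht; clear -he; lia.
  by apply/eqP => E; move: he k0; rewrite -E Ht; clear; lia.
exists (rev s1 ++ inner ++ s2); split.
- have := chain_rev adj_sym c1.
  case Ek : k => [|k'].
    rewrite /inner Ek /= => c1'; apply: chain_cat c1' _ c2; rewrite Eb'.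
    have -> : cdist b b' = 1 by move: Ek; rewrite /k; clear -k0; lia.
    rewrite addn1; apply: cw_adj uh _ _; move: kh; clear -k0; lia.
  move=> c1'; rewrite /inner Ek.
  apply: (chain_cat c1' _ (chain_cat (chain_warc uh b.+1 (n := k') _) _ c2)).
  + by apply: cw_adj uh _ _; move: kh; clear -k0; lia.
  + by move: kh Ek; rewrite /k; clear; lia.
  rewrite Eb'; have -> : b + cdist b b' = (b.+1 + k').+1 by move: Ek; rewrite /k; clear; lia.
  by apply: cw_adj uh _ _; move: kh; clear -k0; lia.
- apply: uniq_cat_disjoint; first by rewrite rev_uniq; have := uP b; rewrite E1 cat_uniq => /andP[].
    apply: uniq_cat_disjoint; first by apply: (uniq_warc uh); move: kh; rewrite /k; clear; lia.
      by have := uP b'; rewrite E2 cat_uniq => /andP[].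
    by move=> z /innerE[t [-> _ tb']] /s2P /u_row E; rewrite E eqxx in tb'.
  move=> z; rewrite mem_rev mem_cat => zs1 /orP[/innerE[t [E tb _]]|zs2].
    by move: zs1; rewrite E => /s1P /u_row E'; rewrite E' eqxx in tb.
  by move: bb'; rewrite (dP b b' z) ?eqxx ?s1P ?s2P.
- move=> z; rewrite !mem_cat mem_rev => /or3P[/s1P/sP//|/innerE[t [-> _ _]]|/s2P/sP//].
  exact: uA.
- rewrite !size_cat size_rev /inner size_warc /k; move: k0.
  by move: (size s1) (size s2) (cdist b b') => x1 x2 x3; clear; lia.
move=> z; rewrite !mem_cat mem_rev => /or3P[zs1|/innerE zi|zs2].
- exact: Or31.
- exact: Or33.
- exact: Or32.
Qed.

Lemma tips_conn i j : i != j -> exists d,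
  [/\ chain adj (tip P i) d (tip P j), uniq d, {subset d <= A0} & cdist i j < size d].
Proof.
move=> ij; have [d [cd ud sd sz _]] := cross_rows ij (esym (cats0 _)) (esym (cats0 _)) (row_chain i) (row_chain j).
by exists d; split=> //; move: sz; rewrite /=; clear; lia.
Qed.

Lemma rows_card : h + \sum_i size (P i) <= #|A0|.
Proof.
have [_ uP sP dP] := PS.
have -> : h + \sum_i size (P i) = \sum_i #|[set v in row P i]|.
  rewrite -[h in h + _]card_ord -sum1_card -big_split /=; apply: eq_bigr => i _.
  by rewrite cardsE (card_uniqP (uP i)).
rewrite (eq_bigr (fun i => \sum_(v in A0) (v \in row P i))); last first.
  move=> i _; rewrite -sum1_card big_mkcond [RHS]big_mkcond /=; apply: eq_bigr => v _.
  rewrite inE; case: (boolP (v \in row P i)) => [/sP->//|_]; by case: ifP.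
rewrite exchange_big /= -sum1_card; apply: leq_sum => v _.
case: (pickP (fun i => v \in row P i)) => [i vi|none]; last by rewrite big1 // => i _; rewrite none.
rewrite (bigD1 i) //= vi big1 // => j ji; case: (boolP (v \in row P j)) => // vj.
by rewrite (dP _ _ _ vj vi) eqxx in ji.
Qed.

End Rows.

Lemma score_upd P i s : spoke_score (upd P i s) + (size (P i) + (P i != [::])) =
  spoke_score P + (size s + (s != [::])).
Proof.
rewrite /spoke_score (bigD1 i) //= [in RHS](bigD1 i) //= /upd eqxx.
rewrite (eq_bigr (fun j => size (P j) + (P j != [::]))); last by move=> j /negPf->.
by move: (\sum_(_ | _) _) (size s + _) (size (P i) + _) => x y z; clear; lia.
Qed.

Section MaxRows.

Variable P : 'I_h -> seq V.
Hypothesis PM : max_spokes P.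
Let PS : spokes P := proj1 PM.

(** Otherwise [v] would extend spoke [i] and raise the score. *)
Lemma tip_nbr_row i v : v \in A0 -> adj (tip P i) v -> exists b, v \in row P b.
Proof.
move=> vA wv; have [pP uP sP dP] := PS.
case: (classic (exists b, v \in row P b)) => // none; exfalso.
have vN b : v \notin row P b by apply/negP => vb; apply: none; exists b.
have PS' : spokes (upd P i (rcons (P i) v)).
  split=> [j|j|j z|j k z]; rewrite /row /upd.
  - by case: eqP => [->|//]; rewrite rcons_path pP.
  - case: (eqVneq j i) => [->|_]; last exact: uP.
    by rewrite (_ : _ :: _ = rcons (row P i) v) // rcons_uniq vN uP.
  - case: eqP => [->|_]; last exact: sP.
    by rewrite (_ : _ :: _ = rcons (row P i) v) // mem_rcons inE => /orP[/eqP->//|]; apply: sP.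
  - have mem (l : 'I_h) x : x \in u l :: (if l == i then rcons (P i) v else P l) ->
       x \in row P l \/ (l = i /\ x = v).
      case: eqP => [->|_]; last by left.
      by rewrite (_ : _ :: _ = rcons (row P i) v) // mem_rcons inE => /orP[/eqP->|]; [right|left].
    move=> /mem[zj|[-> zv]] /mem[zk|[-> zv']]; first exact: dP zj zk.
    + by move: zj; rewrite zv' (negPf (vN j)).
    + by move: zk; rewrite zv (negPf (vN k)).
    by [].
have := proj2 PM _ PS'; have := score_upd P i (rcons (P i) v).
rewrite size_rcons; case: (P i) => /=; clear; lia.
Qed.

(** If [v] were deeper in row [b], moving it and everything beyond it to row [i] would keep the
    total length and earn the bonus of one more nonempty spoke. *)
Lemma bare_row_nbr i b v : P i = [::] -> v \in row P b -> b != i -> adj (u i) v ->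
  v = u b \/ exists s, P b = v :: s.
Proof.
move=> Pi vb bi iv; have [pP uP sP dP] := PS.
have [s1 [s2 [E c1 c2]]] := chain_prefix (row_chain PS b) vb.
case: s1 E c1 => [|x s1] E c1; first by left; case: E.
case: s1 E c1 => [|y s1] E c1; first by right; exists s2; case: E.
exfalso; have [Ex EP] : u b = x /\ P b = (y :: s1) ++ v :: s2 by case: E.
pose P' := upd (upd P b (y :: s1)) i (v :: s2).
have rowi : row P' i = u i :: v :: s2 by rewrite /row /P' /upd eqxx.
have rowb : row P' b = u b :: y :: s1 by rewrite /row /P' /upd (negPf bi) eqxx.
have rowo j : j != i -> j != b -> row P' j = row P j.
  by rewrite /row /P' /upd => /negPf-> /negPf->.
have sub_i z : z \in v :: s2 -> z \in row P b by rewrite /row EP -cat_cons mem_cat => ->; rewrite orbT.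
have sub_b z : z \in u b :: y :: s1 -> z \in row P b.
  by rewrite /row EP -cat_cons mem_cat => ->.
have ubrow := uP b; rewrite /row EP -cat_cons cat_uniq in ubrow.
have /and3P[ub1 /hasPn ub2 ub3] := ubrow.
have PS' : spokes P'.
  split=> [j|j|j z|j k z].
  - rewrite /P' /upd; case: eqP => [->|_].
      by move: c2 => /= /and3P[_ -> _]; rewrite iv.
    case: eqP => [->|//]; have := pP b; rewrite EP cat_path => /andP[] //.
  - have [->|ji] := eqVneq j i.
      rewrite rowi cons_uniq ub3 andbT; apply/negP => /sub_i /(u_row PS) E'.
      by rewrite E' eqxx in bi.
    by have [->|jb] := eqVneq j b; [rewrite rowb|rewrite rowo //; apply: uP].
  - have [->|ji] := eqVneq j i.
      by rewrite rowi inE => /orP[/eqP->|/sub_i/sP//]; apply: uA.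
    by have [->|jb] := eqVneq j b; [rewrite rowb => /sub_b/sP|rewrite rowo //; apply: sP].
  have mem l t : t \in row P' l -> [\/ [/\ l != i, l != b & t \in row P l],
      l = i /\ (t = u i \/ t \in v :: s2) | l = b /\ t \in u b :: y :: s1].
    have [->|li] := eqVneq l i.
      by rewrite rowi inE => /orP[/eqP->|xs]; apply: Or32; split=> //; [left|right].
    by have [->|lb] := eqVneq l b; [rewrite rowb => xs; apply: Or33|rewrite rowo // => xs; apply: Or31].
  have AB l t : l != i -> l != b -> t \in row P l -> (t = u i \/ t \in v :: s2) -> False.
    move=> li lb xl [xi|/sub_i xb].
      by move: li; rewrite -(u_row PS (i := l) (b := i)) ?eqxx // -xi.
    by move: lb; rewrite (dP l b t) // eqxx.
  have AC l t : l != b -> t \in row P l -> t \in u b :: y :: s1 -> False.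
    by move=> lb xl /sub_b xb; move: lb; rewrite (dP l b t) // eqxx.
  have BC t : (t = u i \/ t \in v :: s2) -> t \in u b :: y :: s1 -> False.
    move=> [->|xs] xb; last by have := ub2 t xs; rewrite /= xb.
    by move: bi; rewrite (u_row PS (sub_b _ xb)) eqxx.
  case/mem => [[ji jb zj]|[-> zj]|[-> zj]] /mem[[ki kb zk]|[-> zk]|[-> zk]] //.
  - exact: dP zj zk.
  - by case: (AB _ _ ji jb zj zk).
  - by case: (AC _ _ jb zj zk).
  - by case: (AB _ _ ki kb zk zj).
  - by case: (BC _ zj zk).
  - by case: (AC _ _ kb zk zj).
  - by case: (BC _ zk zj).
have := proj2 PM _ PS'; have := score_upd (upd P b (y :: s1)) i (v :: s2).
have := score_upd P b (y :: s1).
have -> : upd P b (y :: s1) i = [::] by rewrite /upd eq_sym (negPf bi) Pi.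
by rewrite /P' EP size_cat /=; clear; lia.
Qed.

Definition nbrs i := [set v in A0 | adj (tip P i) v].

(** The tip ends its row, so a prefix containing it is the whole row and ends in [v] = tip, which is
    not adjacent to itself. *)
Lemma tip_notin_prefix i b s v t : row P b = rcons s v ++ t -> adj (tip P i) v ->
  tip P i \in rcons s v -> False.
Proof.
move=> E iv ts; have [_ uP _ dP] := PS.
have bi : b = i by apply: dP (tip_row P i); rewrite E mem_cat ts.
subst b; have Et : tip P i = last (u i) (row P i) by [].
case/lastP: t E => [|t x] E.
  by move: iv; rewrite Et E cats0 last_rcons adj_irr.
move: (uP i); rewrite E cat_uniq => /and3P[_ /hasPn nh _].
have /nh /= : x \in rcons t x by rewrite mem_rcons mem_head.
by move: ts; rewrite Et E last_cat last_rcons => ->.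
Qed.

Lemma tip_long_row i (t : 'I_h) : P i != [::] -> tip P i = u t -> False.
Proof.
move=> Pi E; have [_ uP _ _] := PS.
have it : i = t by apply: (u_row PS); rewrite -E tip_row.
have ui : u i \in P i.
  by rewrite {1}it -E /tip; case: (P i) Pi => //= x s _; apply: mem_last.
by have := uP i; rewrite /row cons_uniq ui.
Qed.

(** The tip closes the path of [cross_rows] between its two neighbours to a cycle within [A0], which
    has at most h vertices. *)
Lemma tip_nbr_cdist i b b' s v t s' v' t' : P i != [::] -> b != b' ->
  row P b = rcons s v ++ t -> chain adj (u b) (rcons s v) v ->
  row P b' = rcons s' v' ++ t' -> chain adj (u b') (rcons s' v') v' ->
  adj (tip P i) v -> adj (tip P i) v' ->
  size s + size s' + 2 <= cdist b' b.
Proof.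
move=> Pi bb' E c E' c' iv iv'; have [_ _ sP _] := PS.
have [d [cd ud sd sz dE]] := cross_rows PS bb' E E' c c'.
have cyc := chain_cycle (chain_cons iv cd).
rewrite adj_sym in iv'; have := maxh (cyc iv'); rewrite /= ud andbT.
have td : tip P i \notin d.
  apply/negP => /dE[ts|ts|[k [Ek _ _]]].
  - exact: tip_notin_prefix E iv ts.
  - by rewrite adj_sym in iv'; apply: tip_notin_prefix E' iv' ts.
  - exact: tip_long_row Pi Ek.
move=> /(_ td) H; have : (size d).+1 <= h.
  by apply: H => z; rewrite inE => /orP[/eqP->|/sd//]; apply: sP (tip_row P i).
move: sz (cdist_sym bb'); rewrite !size_rcons.
by move: (cdist _ _) (cdist _ _) => x y; clear; lia.
Qed.

(* By maximality of h, neighbours of the tip in distinct rows are far apart.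
   Hence, if v at depth q v in row b runs over the neighbours, the positions
   b + q v and b - q v - 1 on the cycle are all distinct, unless all
   neighbours lie in row i itself. *)
Lemma long_row_bound i : P i != [::] ->
  #|nbrs i| <= h.-1 /\ 2 * #|nbrs i| <= h.-1 + size (P i).
Proof.
move=> Pi; have [_ uP sP dP] := PS.
pose rw v := odflt i [pick b | v \in row P b].
pose q v := index v (row P (rw v)).
have rwP v : v \in nbrs i -> v \in row P (rw v).
  rewrite inE => /andP[vA iv]; rewrite /rw; case: pickP => //= none.
  by have [b vb] := tip_nbr_row vA iv; have := none b; rewrite vb.
have rwE v b : v \in row P b -> v \in row P (rw v) -> rw v = b by move=> vb vr; apply: dP vr vb.
have pre v : v \in nbrs i -> exists s t,
    [/\ row P (rw v) = rcons s v ++ t, chain adj (u (rw v)) (rcons s v) v & size s = q v].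
  move=> /rwP vr; have [s [t [E c _]]] := chain_prefix (row_chain PS (rw v)) vr.
  exists s, t; rewrite cat_rcons; split=> //.
  have := uP (rw v); rewrite /q E cat_uniq => /and3P[_ /hasPn nh _].
  rewrite index_cat (negPf (nh v (mem_head _ _))) /= eqxx addn0 //.
have dist v v' : v \in nbrs i -> v' \in nbrs i -> rw v != rw v' ->
    q v + q v' + 2 <= cdist (rw v) (rw v').
  move=> vN vN' rr; have [s [t [E c <-]]] := pre v vN; have [s' [t' [E' c' <-]]] := pre v' vN'.
  rewrite (addnC (size s)); rewrite eq_sym in rr.
  move: vN vN'; rewrite !inE => /andP[_ iv] /andP[_ iv'].
  exact: tip_nbr_cdist rr E' c' E c iv' iv.
have qinj v v' : v \in nbrs i -> v' \in nbrs i -> rw v = rw v' -> q v = q v' -> v = v'.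
  move=> /rwP vr /rwP vr' rr; rewrite /q rr => E.
  by rewrite -(nth_index v vr') -E nth_index // -rr.
case: (classic (exists v v', [/\ v \in nbrs i, v' \in nbrs i & rw v != rw v'])); last first.
  move=> same; case: (set_0Vmem (nbrs i)) => [->|[v0 v0N]].
    by rewrite cards0 muln0.
  (* The vertex before the tip is a neighbour in row [i], so the common row is [i]. *)
  have [v1 v1N v1i] : exists2 v, v \in nbrs i & v \in row P i.
    case/lastP Ei: (P i) Pi => [//|s x] _; exists (last (u i) s).
      rewrite inE; apply/andP; split.
        by apply: (sP i); rewrite /row Ei -rcons_cons mem_rcons inE mem_last orbT.
      by case: PS => /(_ i) + _ _ _; rewrite /tip Ei last_rcons rcons_path adj_sym => /andP[].
    by rewrite /row Ei -rcons_cons mem_rcons inE mem_last orbT.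
  have rwi v : v \in nbrs i -> rw v = i.
    move=> vN; rewrite -(rwE v1 i v1i (rwP v1 v1N)); apply/eqP/negPn/negP => ne.
    by apply: same; exists v, v1.
  (* The part of row [i] from the neighbour nearest to the root up to the tip closes to a cycle
     containing the tip and all its neighbours. Its length is at most h, and at most one more than
     that of the spoke. *)
  case: (arg_minnP q v0N) => v vN' minq; have vN : v \in nbrs i by exact: vN'.
  have vi : v \in row P i by rewrite -(rwi v vN) rwP.
  have [s1 [s2 [E c1 c2]]] := chain_prefix (row_chain PS i) vi.
  have qv : q v = size s1.
    have := uP i; rewrite /q rwi // E cat_uniq => /and3P[_ /hasPn nh _].
    by rewrite index_cat (negPf (nh v (mem_head _ _))) /= eqxx addn0.
  have us2 : uniq (v :: s2) by have := uP i; rewrite E cat_uniq => /and3P[].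
  have sh : size (v :: s2) <= h.
    apply: maxh => //; first by apply: chain_cycle c2 _; move: vN; rewrite [v \in _]inE => /andP[].
    by move=> z zs; apply: (sP i); rewrite E mem_cat zs orbT.
  have sub : tip P i |: nbrs i \subset [set z in v :: s2].
    apply/subsetP => z; rewrite in_setU1 => /orP[/eqP->|zN].
      by rewrite inE (chain_last c2).
    have := minq z zN; rewrite qv inE => qz.
    have := rwP z zN; rewrite rwi // E mem_cat => /orP[zs|//].
    by move: qz; rewrite /q rwi // E index_cat zs leqNgt index_mem zs.
  have tN : tip P i \notin nbrs i by rewrite inE adj_irr andbF.
  have cs2 : #|[set z in v :: s2]| = size (v :: s2) by rewrite cardsE; apply/card_uniqP.
  have := subset_leq_card sub; rewrite cardsU1 tN cs2.
  have := congr1 size E; move: sh; rewrite size_cat /=.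
  by move: #|nbrs i| => N; clear; lia.
move=> [v1 [v2 [v1N v2N v12]]].
(* The distances between two rows in the two directions add up to h, which keeps every depth below h
   / 2. *)
have other v : v \in nbrs i -> 2 * (q v) + 4 <= h.
  move=> vN; have [v' [v'N vv']] : exists v', v' \in nbrs i /\ rw v != rw v'.
    have [E|ne] := eqVneq (rw v) (rw v1); last by exists v1.
    by exists v2; rewrite E.
  have := dist v v' vN v'N vv'; have := cdist_sym vv'.
  rewrite eq_sym in vv'; have := dist v' v v'N vN vv'.
  by move: (cdist _ _) (cdist _ _) => x y; clear; lia.
have /functional_choice[f Hf] : forall v, exists k, v \in nbrs i -> cdist (rw v) k = q v.
  move=> v; case: (boolP (v \in nbrs i)) => [vN|_]; last by exists i.
  have [|k Hk] := @cdist_surj h (rw v) (q v); last by exists k.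
  by have := other v vN; clear; lia.
have /functional_choice[g Hg] : forall v, exists k, v \in nbrs i -> cdist k (rw v) = (q v).+1.
  move=> v; case: (boolP (v \in nbrs i)) => [vN|_]; last by exists i.
  have := other v vN => qh; have [|k Hk] := @cdist_surj h (rw v) (h - (q v).+1); first by clear -qh; lia.
  exists k => _; have : rw v != k by rewrite -cdist_gt0 Hk; clear -qh; lia.
  by move/cdist_sym; rewrite Hk; move: (cdist _ _) => x; clear -qh; lia.
have finj : {in nbrs i &, injective f}.
  move=> v v' vN vN' E; have Ev := Hf v vN; have Ev' := Hf v' vN'; rewrite E in Ev.
  have [rr|rr] := eqVneq (rw v) (rw v'); first by apply: qinj; rewrite // -Ev -Ev' rr.
  have d1 := dist _ _ vN vN' rr; have r' := rr; rewrite eq_sym in r'.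
  have d2 := dist _ _ vN' vN r'; exfalso; move: Ev Ev' d1 d2.
  rewrite !cdistE; move: (ltn_ord (rw v)) (ltn_ord (rw v')) (ltn_ord (f v')); clear.
  by case: (leqP (rw v) (f v')); case: (leqP (rw v') (f v')); case: (leqP (rw v) (rw v'));
    case: (leqP (rw v') (rw v)); lia.
have ginj : {in nbrs i &, injective g}.
  move=> v v' vN vN' E; have Ev := Hg v vN; have Ev' := Hg v' vN'; rewrite E in Ev.
  have [rr|rr] := eqVneq (rw v) (rw v').
    by apply: qinj; rewrite // ; apply/eqP; rewrite -eqSS -Ev -Ev' rr.
  have d1 := dist _ _ vN vN' rr; have r' := rr; rewrite eq_sym in r'.
  have d2 := dist _ _ vN' vN r'; exfalso; move: Ev Ev' d1 d2.
  rewrite !cdistE; move: (ltn_ord (rw v)) (ltn_ord (rw v')) (ltn_ord (g v')); clear.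
  by case: (leqP (g v') (rw v)); case: (leqP (g v') (rw v')); case: (leqP (rw v) (rw v'));
    case: (leqP (rw v') (rw v)); lia.
have fgdisj : [disjoint f @: nbrs i & g @: nbrs i].
  apply/pred0P => k /=; apply/negP => /andP[/imsetP[v vN Ek] /imsetP[v' vN' E]].
  have Ev := Hf v vN; have Ev' := Hg v' vN'; rewrite -E in Ev'; rewrite -Ek in Ev.
  have o1 := other v vN; have o2 := other v' vN'.
  have [rr|rr] := eqVneq (rw v) (rw v').
    move: Ev Ev' o1 o2; rewrite rr !cdistE; move: (ltn_ord (rw v')) (ltn_ord k); clear.
    by case: (leqP (rw v') k); case: (leqP k (rw v')); lia.
  have d1 := dist _ _ vN vN' rr; move: Ev Ev' d1 o1 o2.
  rewrite !cdistE; move: (ltn_ord (rw v)) (ltn_ord (rw v')) (ltn_ord k); clear.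
  by case: (leqP (rw v) k); case: (leqP k (rw v')); case: (leqP (rw v) (rw v')); lia.
have le2 : 2 * #|nbrs i| <= h.
  have := max_card [in f @: nbrs i :|: g @: nbrs i].
  rewrite card_ord cardsU (_ : _ :&: _ = set0) ?cards0 ?subn0; last first.
    by apply/eqP; rewrite setI_eq0.
  by rewrite !card_in_imset //; move: #|nbrs i|; clear; lia.
have N0 : 0 < #|nbrs i| by apply/card_gt0P; exists v1.
have Pi0 : 0 < size (P i) by rewrite lt0n size_eq0.
by move: le2 N0 Pi0; move: #|nbrs i| (size (P i)); clear; lia.
Qed.

Definition cycle_nbrs i := [set k : 'I_h | adj (u i) (u k)].
Definition spoke_nbrs i := [set b : 'I_h | (P b != [::]) && adj (u i) (head (u b) (P b))].

(** By [tip_nbr_row] and [bare_row_nbr], such a neighbour is on the cycle or is the first vertex of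
    a spoke. *)
Lemma bare_nbrs_le i : P i = [::] -> #|nbrs i| <= #|cycle_nbrs i| + #|spoke_nbrs i|.
Proof.
move=> Pi; pose y (b : 'I_h) := head (u b) (P b).
apply: leq_trans (_ : #|[set u k | k : 'I_h in cycle_nbrs i] :|: [set y k | k in spoke_nbrs i]| <= _).
  apply: subset_leq_card; apply/subsetP => v; rewrite inE => /andP[vA].
  have tipE : tip P i = u i by rewrite /tip Pi.
  rewrite tipE => iv; have [b vb] : exists b, v \in row P b.
    by apply: (@tip_nbr_row i) => //; rewrite tipE.
  have bi : b != i.
    apply: contraTneq vb => ->; rewrite /row Pi inE; apply/eqP => vi.
    by rewrite vi adj_irr in iv.
  rewrite inE; case: (bare_row_nbr Pi vb bi iv) => [E|[s E]].
    by apply/orP; left; rewrite E; apply: imset_f; rewrite inE -E.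
  apply/orP; right; have -> : v = y b by rewrite /y E.
  by apply: imset_f; rewrite inE E.
rewrite cardsU; apply: leq_trans (leq_subr _ _) _.
by apply: leq_add; apply: leq_imset_card.
Qed.

Lemma spoke_head b : P b != [::] -> let y := head (u b) (P b) in
  [/\ y \in A0, y \notin warc u 0 h & adj y (u b)].
Proof.
move=> Pb; have [pP uP sP _] := PS.
case E : (P b) Pb => [//|y s] _ /=; have yb : y \in row P b by rewrite /row E !inE eqxx orbT.
split; first exact: sP yb.
  apply/negP => /mem_warc[t /andP[_ th]]; rewrite add0n in th => yt.
  have bt : b = Ordinal th by apply: (u_row PS); rewrite -yt.
  have yub : y = u b by rewrite yt bt.
  by have := uP b; rewrite /row E -yub cons_uniq mem_head.
by have := pP b; rewrite E adj_sym => /andP[].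
Qed.

End MaxRows.

(** The cycle o, u_b ... u_(i+1) (backwards), u_(b+1) ... u_i would have h + 1 vertices. *)
Lemma twin_succ (i b : nat) o : i < b -> b < i + h -> o \in A0 -> o \notin warc u 0 h ->
  adj o (u i) -> adj o (u b) -> adj (u i.+1) (u b.+1) -> False.
Proof.
move=> ib bih oA oQ oi ob ibadj.
have cA := chain_warc uh i.+1 (n := b - i.+1) ltac:(lia).
rewrite (_ : i.+1 + (b - i.+1) = b) in cA; last by lia.
have cB := chain_warc uh b.+1 (n := i + h - b.+1) ltac:(lia).
rewrite (_ : b.+1 + (i + h - b.+1) = i + h) ?(cw_period uh) in cB; last by lia.
have io : adj (u i) o by rewrite adj_sym.
have cyc := chain_cycle (chain_cons ob (chain_cat (chain_rev adj_sym cA) ibadj cB)) io.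
move: (maxh cyc); set A := warc _ _ _; set B := warc _ b.+1 _ => H.
have perm : perm_eq (o :: rev A ++ B) (o :: warc u i.+1 h).
  have Eh : h = (b - i.+1).+1 + (i + h - b.+1).+1 by clear -ib bih; lia.
  rewrite perm_cons [in X in perm_eq _ X]Eh warcD.
  rewrite (_ : i.+1 + (b - i.+1).+1 = b.+1); last by clear -ib; lia.
  by rewrite perm_cat2r perm_rev.
have := cw_gt0 uh; move: H; rewrite (perm_uniq perm) (perm_size perm) /= size_warc => H _.
have : h < h; last by rewrite ltnn.
apply: H; first rewrite (uniq_warc uh) // andbT.
  by apply: contra oQ => /(mem_warc_full uh) oQ; apply/(mem_warc_full uh).
move=> z; rewrite (perm_mem perm) inE => /orP[/eqP->//|/mem_warc[t _ ->]]; exact: uA.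
Qed.

(** Likewise with the cycle o, u_(i+1) ... u_b, u_i ... u_(b+1) (backwards). *)
Lemma twin_pred (i b : nat) o : i < b -> b < i + h -> o \in A0 -> o \notin warc u 0 h ->
  adj o (u i.+1) -> adj o (u b.+1) -> adj (u i) (u b) -> False.
Proof.
move=> ib bih oA oQ oi ob ibadj.
have cA := chain_warc uh i.+1 (n := b - i.+1) ltac:(lia).
rewrite (_ : i.+1 + (b - i.+1) = b) in cA; last by lia.
have cB := chain_warc uh b.+1 (n := i + h - b.+1) ltac:(lia).
rewrite (_ : b.+1 + (i + h - b.+1) = i + h) ?(cw_period uh) in cB; last by lia.
have bo : adj (u b.+1) o by rewrite adj_sym.
have biadj : adj (u b) (u i) by rewrite adj_sym.
have cyc := chain_cycle (chain_cons oi (chain_cat cA biadj (chain_rev adj_sym cB))) bo.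
move: (maxh cyc); set A := warc _ _ _; set B := warc _ b.+1 _ => H.
have perm : perm_eq (o :: A ++ rev B) (o :: warc u i.+1 h).
  have Eh : h = (b - i.+1).+1 + (i + h - b.+1).+1 by clear -ib bih; lia.
  rewrite perm_cons [in X in perm_eq _ X]Eh warcD.
  rewrite (_ : i.+1 + (b - i.+1).+1 = b.+1); last by clear -ib; lia.
  by rewrite perm_cat2l perm_rev.
have := cw_gt0 uh; move: H; rewrite (perm_uniq perm) (perm_size perm) /= size_warc => H _.
have : h < h; last by rewrite ltnn.
apply: H; first rewrite (uniq_warc uh) // andbT.
  by apply: contra oQ => /(mem_warc_full uh) oQ; apply/(mem_warc_full uh).
move=> z; rewrite (perm_mem perm) inE => /orP[/eqP->//|/mem_warc[t _ ->]]; exact: uA.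
Qed.

Lemma twin_ordS i b o : i != b -> o \in A0 -> o \notin warc u 0 h ->
  adj o (u i) -> adj o (u b) -> ~~ adj (u (ordS i)) (u (ordS b)).
Proof.
move=> ib oA oQ oi ob; apply/negP; rewrite !u_ordS => H.
have := ltn_ord i; have := ltn_ord b; move: ib; rewrite -val_eqE /=; case: (ltngtP i b) => // lt _ bh ih.
  by apply: (twin_succ lt _ oA oQ oi ob H); clear -bh; lia.
by apply: (twin_succ lt _ oA oQ ob oi _); rewrite 1?adj_sym //; clear -ih; lia.
Qed.

Lemma twin_ord_pred i b o : i != b -> o \in A0 -> o \notin warc u 0 h ->
  adj o (u i) -> adj o (u b) -> ~~ adj (u (ord_pred i)) (u (ord_pred b)).
Proof.
rewrite -[i in i != b]ord_predK -[b in _ != b]ord_predK -{2}[i]ord_predK -{2}[b]ord_predK.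
rewrite !u_ordS (inj_eq (can_inj (@ordSK h))); move: (ord_pred i) (ord_pred b) => {}i {}b.
move=> ib oA oQ oi ob; apply/negP => H.
have := ltn_ord i; have := ltn_ord b; move: ib; rewrite -val_eqE /=; case: (ltngtP i b) => // lt _ bh ih.
  by apply: (twin_pred lt _ oA oQ oi ob H); clear -bh; lia.
by apply: (twin_pred lt _ oA oQ ob oi _); rewrite 1?adj_sym //; clear -ih; lia.
Qed.

Lemma card_missing (x : 'I_h) (A : {set 'I_h}) : x \notin A -> #|A| <= h.-1.
Proof.
move=> xA; rewrite -[h in leqRHS]card_ord -(cardsC1 x); apply: subset_leq_card.
by apply/subsetP => k kA; rewrite !inE; apply: contraTneq kA => ->.
Qed.

Lemma card_disjoint3 (x : 'I_h) (A B C : {set 'I_h}) :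
  x \notin A -> x \notin B -> x \notin C ->
  (forall k, k \in A -> k \in B -> False) -> (forall k, k \in A -> k \in C -> False) ->
  (forall k, k \in B -> k \in C -> False) -> #|A| + #|B| + #|C| <= h.-1.
Proof.
move=> xA xB xC AB AC BC.
have dis (X Y : {set 'I_h}) : (forall k, k \in X -> k \in Y -> False) -> #|X :|: Y| = #|X| + #|Y|.
  move=> XY; rewrite cardsU (_ : X :&: Y = set0) ?cards0 ?subn0 //.
  by apply/setP => k; rewrite !inE; apply/negP => /andP[]; apply: XY.
rewrite -dis // -dis; last by move=> k; rewrite inE => /orP[]; [apply: AC|apply: BC].
by apply: (@card_missing x); rewrite !inE !negb_or xA xB xC.
Qed.

Section Edges.

Variables (P : 'I_h -> seq V) (Z1 Z2 : 'I_h -> {set 'I_h}).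
Hypothesis PM : max_spokes P.
(* The chords at u_i, the predecessors of the spokes adjacent to u_(i+1), and
   Z1 i are pairwise disjoint sets of positions, whence bare_edge; Z2 i is the
   mirror image. *)
Hypothesis HZ1 : forall i b, b \in Z1 i -> [/\ b != i, ~~ adj (u i) (u b) &
  forall o, o \in A0 -> o \notin warc u 0 h -> adj o (u (ordS i)) -> adj o (u (ordS b)) -> False].
Hypothesis HZ2 : forall i b, b \in Z2 i -> [/\ b != ordS i, ~~ adj (u (ordS i)) (u b) &
  forall o, o \in A0 -> o \notin warc u 0 h -> adj o (u i) -> adj o (u (ord_pred b)) -> False].
Hypothesis Zsmall : forall i, h * (#|Z1 i| + #|Z2 i|) <= h.-1 * h.-2.

Let h_gt0 : 0 < h := cw_gt0 uh.

Lemma cycle_nbrs_le i : #|cycle_nbrs i| <= h.-1.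
Proof. by apply: (@card_missing i); rewrite inE adj_irr. Qed.

Lemma spoke_nbrs_le i : P i = [::] -> #|spoke_nbrs P i| <= h.-1.
Proof.
by move=> Pi; apply: (@card_missing i); rewrite inE Pi.
Qed.

Lemma bare_edge i : P i = [::] -> P (ordS i) = [::] ->
  #|nbrs P i| + #|nbrs P (ordS i)| + (#|Z1 i| + #|Z2 i|) <= 2 * h.-1.
Proof.
move=> Pi PSi.
have spokeP j b : b \in spoke_nbrs P j -> let y := head (u b) (P b) in
    [/\ y \in A0, y \notin warc u 0 h, adj y (u j) & adj y (u b)].
  by rewrite inE => /andP[/(spoke_head PM)[yA yQ yb] jy]; split=> //; rewrite adj_sym.
have H1 : #|cycle_nbrs i| + #|Z1 i| + #|(@ord_pred h) @: spoke_nbrs P (ordS i)| <= h.-1.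
  apply: (@card_disjoint3 i).
  - by rewrite inE adj_irr.
  - by apply/negP => /HZ1[]; rewrite eqxx.
  - by apply/imsetP => -[b + ib]; rewrite -[b]ord_predK -ib inE PSi.
  - by move=> k; rewrite inE => ik /HZ1[_ /negP].
  - move=> k + /imsetP[b bS E]; rewrite inE E; have [yA yQ yi yb] := spokeP _ _ bS.
    rewrite -{1}[i](@ordSK h); apply/negP; apply: twin_ord_pred yA yQ yi yb.
    by apply: contraTneq bS => <-; rewrite inE PSi.
  move=> k /HZ1[_ _ nk] /imsetP[b bS E]; have [yA yQ yi yb] := spokeP _ _ bS.
  by apply: (nk _ yA yQ yi); rewrite E ord_predK.
have H2 : #|cycle_nbrs (ordS i)| + #|Z2 i| + #|(@ordS h) @: spoke_nbrs P i| <= h.-1.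
  apply: (@card_disjoint3 (ordS i)).
  - by rewrite inE adj_irr.
  - by apply/negP => /HZ2[]; rewrite eqxx.
  - by apply/imsetP => -[b + /(can_inj (@ordSK h)) ib]; rewrite -ib inE Pi.
  - by move=> k; rewrite inE => ik /HZ2[_ /negP].
  - move=> k + /imsetP[b bS E]; rewrite inE E; have [yA yQ yi yb] := spokeP _ _ bS.
    apply/negP; apply: twin_ordS yA yQ yi yb.
    by apply: contraTneq bS => <-; rewrite inE Pi.
  move=> k /HZ2[_ _ nk] /imsetP[b bS E]; have [yA yQ yi yb] := spokeP _ _ bS.
  by apply: (nk _ yA yQ yi); rewrite E ordSK.
rewrite card_imset in H1; last exact: can_inj (@ord_predK h).
rewrite card_imset in H2; last exact: can_inj (@ordSK h).
have := bare_nbrs_le PM Pi; have := bare_nbrs_le PM PSi.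
move: H1 H2; move: #|_| #|_| #|_| #|_| #|_| #|_| #|_| #|_|; clear; lia.
Qed.

(* Each edge i, i+1 of the cycle splits the weight 2 (h + 1) between its ends:
   equally, or mostly in favour of the end with a spoke, whose length then
   compensates for the weak degree bound of the bare end. *)
Definition spoke_weight i j :=
  if (P i != [::]) == (P j != [::]) then h.+1 else if P i != [::] then 2 * h else 2.

(** Two bare ends are settled by [bare_edge]. With one bare end, at most 2 (h - 1) neighbours have
    weight 2 and at most (h - 1 + p) / 2 have weight 2 h, where p is the length of the spoke; what
    remains on the right is exactly (h - 1) (h - 2), the allowance in [Zsmall]. *)
Lemma edge_bound i : let j := ordS i in
  spoke_weight i j * #|nbrs P i| + spoke_weight j i * #|nbrs P j| + h * (#|Z1 i| + #|Z2 i|)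
    <= 2 * h.+1 * h.-1 + h * (size (P i) + size (P j)).
Proof.
rewrite /= /spoke_weight; set j := ordS i.
have bare_le k : P k = [::] -> #|nbrs P k| <= 2 * h.-1.
  move=> Pk; apply: leq_trans (bare_nbrs_le PM Pk) _.
  have := cycle_nbrs_le k; have := spoke_nbrs_le Pk.
  by move: #|_| #|_|; clear; lia.
have := Zsmall i; have h0 := h_gt0.
case: (eqVneq (P i) [::]) => Pi; case: (eqVneq (P j) [::]) => Pj /=.
- have := bare_edge Pi Pj; rewrite -/j; move: (#|nbrs P i|) (#|nbrs P j|) (#|Z1 i| + #|Z2 i|) => x y z.
  clear -h0; nia.
- have := bare_le i Pi; have [_] := long_row_bound PM Pj.
  rewrite Pi /=; move: (#|nbrs P i|) (#|nbrs P j|) (#|Z1 i| + #|Z2 i|) (size _) => x y z p.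
  clear -h0; nia.
- have := bare_le j Pj; have [_] := long_row_bound PM Pi.
  rewrite Pj /=; move: (#|nbrs P i|) (#|nbrs P j|) (#|Z1 i| + #|Z2 i|) (size _) => x y z p.
  clear -h0; nia.
have [] := long_row_bound PM Pj; have [] := long_row_bound PM Pi.
move: (#|nbrs P i|) (#|nbrs P j|) (#|Z1 i| + #|Z2 i|) (size (P i)) (size (P j)) => x y z p q.
clear -h0; nia.
Qed.

End Edges.

End Spokes.

(** * The weighted degree count over all tips *)

Section SpokeBound.

Variables (V : finType) (adj : rel V).
Hypotheses (adj_sym : symmetric adj) (adj_irr : irreflexive adj).

(** The tip of a nonempty spoke serves, by [long_row_bound]; if all spokes are empty, the neighbours
    of u_0 are all on the cycle. Applied to the whole graph, this puts the minimum degree below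
    c. *)
Lemma low_degree_vertex (A0 : {set V}) u h : cyclic_walk adj u h -> (forall i, u i \in A0) ->
  cycle_bound adj [in A0] h -> exists2 v, v \in A0 & #|[set y in A0 | adj v y]| < h.
Proof.
move=> uh uA maxh; have h0 := cw_gt0 uh.
have [P PM] := exists_max_spokes uh uA; have [_ _ sP _] := proj1 PM.
case: (classic (exists i, P i != [::])) => [[i Pi]|none].
  exists (tip u P i); first by apply: (sP i); apply: tip_row.
  have [le _] := long_row_bound adj_sym adj_irr uh uA maxh PM Pi.
  by apply: leq_ltn_trans le _; rewrite prednK.
have bare i : P i = [::] by apply/eqP/negPn/negP => Pi; apply: none; exists i.
pose i0 := Ordinal h0; exists (tip u P i0); first by apply: (sP i0); apply: tip_row.
have := bare_nbrs_le adj_irr uA PM (bare i0).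
have := cycle_nbrs_le adj_irr u i0.
rewrite (_ : spoke_nbrs _ _ _ _ = set0) ?cards0; last by apply/setP => b; rewrite !inE bare.
rewrite addn0 => le1 le2; apply: leq_ltn_trans (leq_trans le2 le1) _; by rewrite prednK.
Qed.

Variables (cc : nat -> V) (c : nat).
Hypotheses (ccyc : cyclic_walk adj cc c) (maxc : cycle_bound adj predT c).
Let A0 := ~: [set y in warc cc 0 c].
Variables (u : nat -> V) (h : nat).
Hypotheses (uh : cyclic_walk adj u h) (uA : forall i, u i \in A0).
Hypothesis maxh : cycle_bound adj [in A0] h.
Variables (Z1 Z2 : 'I_h -> {set 'I_h}).
Hypothesis HZ1 : forall i b, b \in Z1 i -> [/\ b != i, ~~ adj (u i) (u b) &
  forall o, o \in A0 -> o \notin warc u 0 h -> adj o (u (ordS i)) -> adj o (u (ordS b)) -> False].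
Hypothesis HZ2 : forall i b, b \in Z2 i -> [/\ b != ordS i, ~~ adj (u (ordS i)) (u b) &
  forall o, o \in A0 -> o \notin warc u 0 h -> adj o (u i) -> adj o (u (ord_pred b)) -> False].
Hypothesis Zsmall : forall i, h * (#|Z1 i| + #|Z2 i|) <= h.-1 * h.-2.
Hypothesis hc : h < c.

(** The spoke lengths on the right of [edge_bound] cancel, since by [rows_card] the spokes occupy as
    many vertices off C. *)
Lemma spoke_bound d : (forall x, d <= #|[set y | adj x y]|) ->
  2 * h.+1 * d + \sum_i (#|Z1 i| + #|Z2 i|) + 2 * h + 2 <= 2 * #|V| + 2 * h * h.
Proof.
move=> dmin; have h0 := cw_gt0 uh.
have [P PM] := exists_max_spokes uh uA; have [_ _ sP _] := proj1 PM.
pose sw := spoke_weight P.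
(* A tip collects the shares of the two cycle edges at its root, at most 2 h from each; the [h]
   edges give out 2 (h + 1) each. This fits [weighted_attachments] with K = 2 h. *)
pose om i := sw i (ordS i) + sw i (ord_pred i).
have swle i j : sw i j <= 2 * h by rewrite /sw /spoke_weight; case: ifP => _; [|case: ifP => _]; lia.
have swsum i j : sw i j + sw j i = 2 * h.+1.
  by rewrite /sw /spoke_weight; case: (P i != _); case: (P j != _) => /=; lia.
have reind (F : 'I_h -> nat) : \sum_i F i = \sum_i F (ordS i).
  by rewrite (reindex (@ordS h)) //; exists (@ord_pred h) => i _; [apply: ordSK|apply: ord_predK].
have om_sum (phi : 'I_h -> nat) :
    \sum_i om i * phi i = \sum_i (sw i (ordS i) * phi i + sw (ordS i) i * phi (ordS i)).
  rewrite big_split /= (eq_bigr (fun i => sw i (ordS i) * phi i + sw i (ord_pred i) * phi i)).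
    rewrite big_split /=; congr (_ + _); rewrite reind; apply: eq_bigr => i _.
    by rewrite ordSK.
  by move=> i _; rewrite mulnDl.
have om_total : \sum_i om i = 2 * h * h.+1.
  rewrite (eq_bigr (fun i => om i * 1)); last by move=> i _; rewrite muln1.
  rewrite om_sum (eq_bigr (fun=> 2 * h.+1)); last by move=> i _; rewrite !muln1 swsum.
  by rewrite sum_nat_const card_ord; lia.
have tip_off i : tip u P i \notin warc cc 0 c.
  by have := sP i _ (tip_row u P i); rewrite !inE.
have tconn i j : i != j -> exists d, [/\ chain adj (tip u P i) d (tip u P j), uniq d,
    off cc c d & cdist i j < size d].
  move=> ij; have [e [ce ue se sz]] := tips_conn adj_sym uh uA (proj1 PM) ij.
  by exists e; split=> // z /se; rewrite !inE.
have S1 := weighted_attachments adj_sym ccyc maxc tip_off tconn (om := om) (K := 2 * h).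
have {}S1 : \sum_i om i * #|[set y | adj (tip u P i) y] :&: [set y in warc cc 0 c]| <= 2 * h * c.
  apply: S1 => //; last by rewrite om_total.
  by move=> i; rewrite mulnA mulnn /om; apply: leq_trans (leq_add (swle _ _) (swle _ _)) _; lia.
have S2 i : d <= #|[set y | adj (tip u P i) y] :&: [set y in warc cc 0 c]| + #|nbrs adj A0 u P i|.
  apply: leq_trans (dmin (tip u P i)) _; rewrite -(cardsID [set y in warc cc 0 c]) leq_add2l.
  by apply/subset_leq_card/subsetP => y; rewrite !inE => /andP[-> ->].
have S3 : \sum_i om i * #|nbrs adj A0 u P i| + h * \sum_i (#|Z1 i| + #|Z2 i|) <=
    h * (2 * h.+1 * h.-1) + 2 * h * \sum_i size (P i).
  have E : 2 * h * \sum_i size (P i) = \sum_i h * (size (P i) + size (P (ordS i))).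
    by rewrite -big_distrr big_split /= -(reind (fun i => size (P i))) addnn -mul2n mulnCA mulnA.
  have -> : h * (2 * h.+1 * h.-1) = \sum_(i < h) 2 * h.+1 * h.-1.
    by rewrite sum_nat_const card_ord.
  rewrite E -big_split /= om_sum big_distrr -big_split /=.
  by apply: leq_sum => i _; apply: edge_bound.
have S4 : c + (h + \sum_i size (P i)) <= #|V|.
  have := rows_card (proj1 PM); rewrite -(cardsC [set y in warc cc 0 c]) => le.
  by apply: leq_add le; rewrite cardsE (card_uniqP (uniq_warc ccyc _ _)) // size_warc.
have S5 : 2 * h * h.+1 * d <= 2 * h * c + \sum_i om i * #|nbrs adj A0 u P i|.
  apply: leq_trans (leq_add S1 (leqnn _)); rewrite -big_split /= -om_total big_distrl /=.
  by apply: leq_sum => i _; rewrite -mulnDr leq_mul2l S2 orbT.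
rewrite -(leq_pmul2l h0); move: S3 S4 S5.
move: (\sum_i om i * #|nbrs adj A0 u P i|) (\sum_i size (P i)) (\sum_i (#|Z1 i| + #|Z2 i|)) #|V| => x p z n.
clear -h0 => S3 S4 S5; nia.
Qed.

End SpokeBound.

(** * Chords between two attachments *)

Section Corner.

Variables (V : finType) (adj : rel V).
Hypothesis adj_sym : symmetric adj.
Variables (A0 : {set V}) (u : nat -> V) (h : nat).
Hypotheses (uh : cyclic_walk adj u h) (uA : forall i, u i \in A0).

(** Legs will be the disjoint paths from Q to C without their last vertex, so that [z] is adjacent
    to C. *)
Definition leg e (al : seq V) (z : V) :=
  [/\ chain adj (u e) al z, uniq al, {subset al <= A0} &
      forall v, v \in al -> v \in warc u 0 h -> v = u e].

Lemma leg_walk e al z n : leg e al z -> n < h ->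
  [/\ chain adj z (rev al ++ warc u e.+1 n) (u (e + n)), uniq (rev al ++ warc u e.+1 n) &
      {subset rev al ++ warc u e.+1 n <= A0}].
Proof.
move=> [c ual sal alQ] nh; split.
- have cr := chain_rev adj_sym c; case: n nh => [|n] nh; first by rewrite cats0 addn0.
  have cw := chain_warc uh e.+1 (n := n) ltac:(lia).
  rewrite addSnnS in cw; apply: chain_cat cr _ cw; apply: cw_adj uh _ _; lia.
- apply: uniq_cat_disjoint; rewrite ?rev_uniq ?(uniq_warc uh) // 1?ltnW //.
  move=> v; rewrite mem_rev => va /mem_warc[i hi E].
  have vQ : v \in warc u 0 h by apply/(mem_warc_full uh); exists i.
  have := alQ v va vQ; rewrite E => E'; have [lt1 lt2] : e < i /\ i < e + h by lia.
  exact: (cw_eq_small uh lt1 lt2 (esym E')).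
by move=> v; rewrite mem_cat mem_rev => /orP[/sal//|/mem_warc[i _ ->]].
Qed.

Variables (ax ay : seq V) (zx zy : V) (D : nat).
Hypotheses (D0 : 0 < D) (Dh : D < h) (lx : leg 0 ax zx) (ly : leg D ay zy).
Hypothesis axy : forall v, v \in ax -> v \in ay -> False.

Let ay_warc v i n : v \in ay -> v \in warc u i n -> D < i -> i + n <= D + h -> False.
Proof.
case: ly => _ _ _ ayQ va /mem_warc[e he E] Di inh.
have vQ : v \in warc u 0 h by apply/(mem_warc_full uh); exists e.
have := ayQ v va vQ; rewrite E => E'.
have [lt1 lt2] : D < e /\ e < D + h by lia.
exact: (cw_eq_small uh lt1 lt2 (esym E')).
Qed.

Let ax_warc v i n : v \in ax -> v \in warc u i n -> 0 < i -> i + n <= h -> False.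
Proof.
case: lx => _ _ _ axQ va /mem_warc[e he E] Di inh.
have vQ : v \in warc u 0 h by apply/(mem_warc_full uh); exists e.
have := axQ v va vQ; rewrite E => E'.
have [lt1 lt2] : 0 < e /\ e < 0 + h by lia.
exact: (cw_eq_small uh lt1 lt2 (esym E')).
Qed.

Let warc_disjoint v i m j n : v \in warc u i m -> v \in warc u j n ->
  i + m <= j -> j + n <= i + h -> False.
Proof.
move=> /mem_warc[e he ->] /mem_warc[f hf E] imj jni.
have [lt1 lt2] : e < f /\ f < e + h by lia.
exact: (cw_eq_small uh lt1 lt2 E).
Qed.

Lemma forward_route : exists d, [/\ chain adj zx d zy, uniq d, {subset d <= A0} & D < size d].
Proof.
have [|c ul sl] := leg_walk (n := D.-1) lx; first by lia.
have [cy uy sy _] := ly.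
exists ((rev ax ++ warc u 1 D.-1) ++ ay); split.
- apply: chain_cat c _ cy; rewrite add0n -{2}(prednK D0); apply: cw_adj uh _ _; lia.
- apply: uniq_cat_disjoint => // v; rewrite mem_cat mem_rev => /orP[vx vy|vw vy].
    exact: axy vx vy.
  case/mem_warc: vw => e he E; apply: (ay_warc (i := e + h) (n := 1) vy); try lia.
  by apply/mem_warc; exists (e + h); rewrite ?(cw_period uh) //; lia.
- by move=> v; rewrite mem_cat => /orP[/sl|/sy].
have := chain_size cy; have [cx _ _ _] := lx; have := chain_size cx.
by rewrite !size_cat size_rev size_warc; clear -D0; lia.
Qed.

Lemma backward_route : exists d, [/\ chain adj zy d zx, uniq d, {subset d <= A0} & h - D < size d].
Proof.
have [|c ul sl] := leg_walk (n := h - D.+1) ly; first by lia.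
have [cx ux sx _] := lx.
exists ((rev ay ++ warc u D.+1 (h - D.+1)) ++ ax); split.
- apply: chain_cat c _ cx; have -> : u 0 = u (D + (h - D.+1)).+1.
    by rewrite -(cw_period uh 0); congr u; clear -Dh; lia.
  by apply: cw_adj uh _ _; lia.
- apply: uniq_cat_disjoint => // v; rewrite mem_cat mem_rev => /orP[vy vx|vw vx].
    exact: axy vx vy.
  by apply: (ax_warc vx vw); lia.
- by move=> v; rewrite mem_cat => /orP[/sl|/sx].
have := chain_size cx; have [cy _ _ _] := ly; have := chain_size cy.
by rewrite !size_cat size_rev size_warc; clear -Dh; lia.
Qed.

Variables (vp vq : V) (j : nat).
Hypotheses (xp : adj zx vp) (yq : adj zy vq).
Hypothesis short : forall d a b, chain adj a d b -> uniq d -> {subset d <= A0} ->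
  adj vp a -> adj b vq -> size d + j < h.

Let px : adj vp zx. Proof. by rewrite adj_sym. Qed.
Let qy : adj vq zy. Proof. by rewrite adj_sym. Qed.

Let short_rev d a b : chain adj a d b -> uniq d -> {subset d <= A0} ->
  adj vq a -> adj b vp -> size d + j < h.
Proof.
move=> c ud sd qa bp; rewrite -size_rev; apply: (short (chain_rev adj_sym c)).
- by rewrite rev_uniq.
- by move=> v; rewrite mem_rev; apply: sd.
- by rewrite adj_sym.
by rewrite adj_sym.
Qed.

(** The routes from leg to leg in the two directions have at least D + 1 and h - D + 1 vertices, and
    [short] applies to both. *)
Lemma corner_room : j + 2 <= D /\ D + j + 2 <= h.
Proof.
have [d [c ud sd sz]] := forward_route; have := short c ud sd px yq.
have [d' [c' ud' sd' sz']] := backward_route; have := short_rev c' ud' sd' qy xp.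
by clear -sz sz' Dh; lia.
Qed.

(* The chord would give a detour missing only al + be vertices of the cycle. *)
Lemma corner_nonadj al be : al + be <= j -> ~~ adj (u (D - 1 - al)) (u (h - 1 - be)).
Proof.
move=> abj; have [jD Dj] := corner_room.
set a := D - 1 - al; set b := h - 1 - be; apply/negP => ab.
have [|c1 u1 s1] := leg_walk (n := a) lx; first by rewrite /a; lia.
have [|c2 u2 s2] := leg_walk (n := b - D) ly; first by rewrite /b; lia.
rewrite subnKC in c2; last by rewrite /b; clear -abj jD Dj; lia.
rewrite add0n in c1; have c := chain_cat c1 ab (chain_rev adj_sym c2).
have [cx _ _ _] := lx; have [cy _ _ _] := ly.
have := chain_size cx; have := chain_size cy.
suff : size ((rev ax ++ warc u 1 a) ++ rev (rev ay ++ warc u D.+1 (b - D))) + j < h.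
  rewrite !size_cat !size_rev !size_cat !size_rev !size_warc /a /b.
  by move: (size ax) (size ay) => p q; clear -abj jD Dj; lia.
apply: (short c _ _ px yq).
- apply: uniq_cat_disjoint; rewrite ?rev_uniq // => v; rewrite mem_cat !mem_rev mem_cat mem_rev.
  case/orP => [vx|vw] /orP[vy|vw'].
  + exact: axy vx vy.
  + by apply: (ax_warc vx vw'); rewrite /b; clear -abj jD Dj; lia.
  + case/mem_warc: vw => e he E; apply: (ay_warc (i := e + h) (n := 1) vy).
    * by apply/mem_warc; exists (e + h); rewrite ?(cw_period uh) //; clear; lia.
    * by clear -Dh; lia.
    by move: he; rewrite /a; clear -abj jD Dj; lia.
  by apply: (warc_disjoint vw vw'); rewrite /a /b; clear -abj jD Dj; lia.
by move=> v; rewrite mem_cat mem_rev => /orP[/s1|/s2].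
Qed.

(** As for a chord, but [o] is one more vertex of the detour, which is why the sum may reach j + 1.
    If [o] lies on a leg, the detour comes from the other leg along the cycle to a neighbour of [o]
    and leaves by the rest of that leg. *)
Lemma corner_no_common al be o : al + be <= j.+1 -> o \in A0 -> o \notin warc u 0 h ->
  adj o (u (D - 1 - al)) -> adj o (u (h - 1 - be)) -> False.
Proof.
move=> abj oA oQ; have [jD Dj] := corner_room.
set a := D - 1 - al; set b := h - 1 - be => oa ob.
have [cx ux sx _] := lx; have [cy uy sy _] := ly.
have := chain_size cx; have := chain_size cy.
have aE : a = D - 1 - al by []. have bE : b = h - 1 - be by [].
clearbody a b; have ao : adj (u a) o by rewrite adj_sym.
have bo : adj (u b) o by rewrite adj_sym.
have [ah bh Db] : [/\ a < D, b < h & D <= b] by split; clear -abj jD Dj aE bE; lia.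
(* Down the leg [ay], forward through u_0 to u_a, to [o] and on along [ax]; the part of [ax] from
   [o] on misses u_0 because [o] is not on the cycle. *)
case: (boolP (o \in ax)) => ox.
  have [s1 [s2 [E _ c2]]] := chain_prefix cx ox.
  have [|c1 u1 t1] := leg_walk (n := h + a - D) ly; first by clear -ah Dh; lia.
  rewrite (_ : D + (h + a - D) = a + h) ?(cw_period uh) in c1; last by clear -Dh; lia.
  have c := chain_cat c1 ao c2 => ay0 ax0.
  suff : size ((rev ay ++ warc u D.+1 (h + a - D)) ++ o :: s2) + j < h.
    rewrite !size_cat size_rev size_warc /=; move: (size ay) (size s2) ay0 => p q.
    by clear -abj jD Dj aE; lia.
  have os v : v \in o :: s2 -> v \in ax by move=> vs; rewrite E mem_cat vs orbT.
  apply: (short_rev c _ _ qy xp).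
    apply: uniq_cat_disjoint => //; first by move: ux; rewrite E cat_uniq => /and3P[].
    move=> v; rewrite mem_cat mem_rev => /orP[vy /os vx|vw vs]; first exact: axy vx vy.
    have vQ : v \in warc u 0 h.
      by case/mem_warc: vw => e _ ->; apply/(mem_warc_full uh); exists e.
    move: vs (os _ vs); rewrite inE => /orP[/eqP vo|vs] vx; first by rewrite -vo vQ in oQ.
    have [_ _ _ /(_ v vx vQ) v0] := lx.
    move: ux; rewrite E; case: s1 E => [|x s1] E.
      have ou : o = u 0 by move: cx; rewrite E => /chain_headE.
      by case/negP: oQ; rewrite ou; apply/(mem_warc_full uh); exists 0.
    have -> : x = v by rewrite v0; move: cx; rewrite E => /chain_headE.
    by rewrite /= mem_cat inE vs !orbT.
  by move=> v; rewrite mem_cat => /orP[/t1//|/os/sx].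
case: (boolP (o \in ay)) => oy.
  have [s1 [s2 [E _ c2]]] := chain_prefix cy oy.
  have [|c1 u1 t1] := leg_walk (n := b) lx; first by [].
  rewrite add0n in c1; have c := chain_cat c1 bo c2 => ay0 ax0.
  suff : size ((rev ax ++ warc u 1 b) ++ o :: s2) + j < h.
    rewrite !size_cat size_rev size_warc /=; move: (size ax) (size s2) ax0 => p q.
    by clear -abj jD Dj bE; lia.
  have os v : v \in o :: s2 -> v \in ay by move=> vs; rewrite E mem_cat vs orbT.
  apply: (short c _ _ px yq).
    apply: uniq_cat_disjoint => //; first by move: uy; rewrite E cat_uniq => /and3P[].
    move=> v; rewrite mem_cat mem_rev => /orP[vx /os vy|vw vs]; first exact: axy vx vy.
    have vQ : v \in warc u 0 h.
      by case/mem_warc: vw => e _ ->; apply/(mem_warc_full uh); exists e.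
    move: vs (os _ vs); rewrite inE => /orP[/eqP vo|vs] vy; first by rewrite -vo vQ in oQ.
    have [_ _ _ /(_ v vy vQ) v0] := ly.
    move: uy; rewrite E; case: s1 E => [|x s1] E.
      have ou : o = u D by move: cy; rewrite E => /chain_headE.
      by case/negP: oQ; rewrite ou; apply/(mem_warc_full uh); exists D.
    have -> : x = v by rewrite v0; move: cy; rewrite E => /chain_headE.
    by rewrite /= mem_cat inE vs !orbT.
  by move=> v; rewrite mem_cat => /orP[/t1//|/os/sy].
have [|c1 u1 s1] := leg_walk (n := a) lx; first by clear -ah Dh; lia.
have [|c2 u2 s2] := leg_walk (n := b - D) ly; first by clear -bh; lia.
rewrite subnKC // in c2; rewrite add0n in c1.
have c := chain_cat (chain_rcons c1 ao) ob (chain_rev adj_sym c2) => ay0 ax0.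
suff : size (rcons (rev ax ++ warc u 1 a) o ++ rev (rev ay ++ warc u D.+1 (b - D))) + j < h.
  rewrite size_cat size_rcons !size_cat !size_rev !size_cat !size_rev !size_warc.
  by move: (size ax) (size ay) ax0 ay0 => p q; clear -abj jD Dj aE bE; lia.
have oW i n : o \in warc u i n -> False.
  case/mem_warc => e _ E; case/negP: oQ; rewrite E; apply/(mem_warc_full uh); by exists e.
apply: (short c _ _ px yq).
- apply: uniq_cat_disjoint; rewrite ?rev_uniq //.
    rewrite rcons_uniq u1 andbT mem_cat mem_rev (negPf ox) /=; apply/negP; exact: oW.
  move=> v; rewrite mem_rcons inE mem_cat !mem_rev mem_cat mem_rev.
  case/or3P => [/eqP->|vx|vw] /orP[vy|vw'].
  + by rewrite vy in oy.
  + exact: oW vw'.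
  + exact: axy vx vy.
  + by apply: (ax_warc vx vw'); clear -bh Db; lia.
  + case/mem_warc: vw => e he E; apply: (ay_warc (i := e + h) (n := 1) vy).
    * by apply/mem_warc; exists (e + h); rewrite ?(cw_period uh) //; clear; lia.
    * by clear -Dh; lia.
    by clear -he ah; lia.
  by apply: (warc_disjoint vw vw'); clear -ah bh Db; lia.
by move=> v; rewrite mem_cat mem_rcons inE mem_rev => /orP[/orP[/eqP->|/s1]|/s2].
Qed.

End Corner.

Lemma card_ord_range h lo hi : hi <= h -> #|[set b : 'I_h | lo <= b < hi]| = hi - lo.
Proof.
move=> hih; rewrite -sum1_card big_mkcond /=.
rewrite (eq_bigr (fun b : 'I_h => (lo <= b < hi : nat))); last first.
  by move=> b _; rewrite inE; case: ifP.
rewrite -(big_mkord xpredT (fun b => (lo <= b < hi : nat))).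
case: (leqP lo hi) => lohi; last first.
  rewrite big_nat big1 => [|b _]; first by apply/esym/eqP; rewrite subn_eq0 ltnW.
  by case: (boolP (lo <= b < hi)) => //; clear -lohi; lia.
rewrite (@big_cat_nat _ _ _ lo) //=; last exact: leq_trans hih.
rewrite (@big_cat_nat _ _ _ hi lo) //=.
rewrite big_nat big1 ?add0n; last first.
  by move=> b hb; case: (boolP (lo <= b < hi)) => //; clear -hb; lia.
rewrite [X in _ + X]big_nat [X in _ + X]big1 ?addn0; last first.
  by move=> b hb; case: (boolP (lo <= b < hi)) => //; clear -hb; lia.
by rewrite big_nat (eq_bigr (fun=> 1)) => [|b ->//]; rewrite -big_nat sum_nat_const_nat muln1.
Qed.

Lemma sum_odd j : \sum_(0 <= e < j) (2 * e).+1 = j * j.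
Proof.
elim: j => [|j IH]; first by rewrite big_geq.
by rewrite big_nat_recr //= IH; clear; lia.
Qed.

Section CornerBound.

Variables (V : finType) (adj : rel V).
Hypotheses (adj_sym : symmetric adj) (adj_irr : irreflexive adj).
Variables (cc : nat -> V) (c : nat).
Hypotheses (ccyc : cyclic_walk adj cc c) (maxc : cycle_bound adj predT c).
Let A0 := ~: [set y in warc cc 0 c].
Variables (u : nat -> V) (h : nat).
Hypotheses (uh : cyclic_walk adj u h) (uA : forall i, u i \in A0).
Hypothesis maxh : cycle_bound adj [in A0] h.
Hypothesis hc : h < c.
Variables (j D : nat).
Hypotheses (jD : j + 2 <= D) (Dj : D + j + 2 <= h).
Hypothesis nonadj : forall al be, al + be <= j -> ~~ adj (u (D - 1 - al)) (u (h - 1 - be)).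
Hypothesis no_common : forall al be o, al + be <= j.+1 -> o \in A0 -> o \notin warc u 0 h ->
  adj o (u (D - 1 - al)) -> adj o (u (h - 1 - be)) -> False.

Let side m (i : nat) := (m <= i + j + 1) && (i + 2 <= m).
(** For i = D - 1 - al this is h - 1 - (j - al), and for i = h - 1 - be it is D - 1 - (j - be): in
    both cases the least position barred by [nonadj]. *)
Let lo (i : nat) := h + D - j - 2 - i.
Let top (i : nat) := if side D i then h else if side h i then D else 0.
(* Z1 i and Z2 i are intervals of positions near the opposite attachment; as i
   approaches D or h their total size runs through the odd numbers 1, 3, ...,
   2 j - 1, whence the two squares in corner_bound. *)
Let Z1 (i : 'I_h) := [set b : 'I_h | lo i <= b < (top i).-1].
Let Z2 (i : 'I_h) := [set b : 'I_h | lo i <= b < top i].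

Let card_Z (i : 'I_h) : #|Z1 i| + #|Z2 i| =
  if side D i then (2 * (i - (D - 1 - j))).+1 else
  if side h i then (2 * (i - (h - 1 - j))).+1 else 0.
Proof.
have toph : top i <= h by rewrite /top; case: ifP => // _; case: ifP => // _; clear -Dj; lia.
rewrite /Z1 /Z2 !card_ord_range //; last by apply: leq_trans (leq_pred _) toph.
rewrite /top /lo /side; have := ltn_ord i.
by case: ifP => [|_]; [|case: ifP]; clear -jD Dj; lia.
Qed.

Let ord_predE (b : 'I_h) : 0 < b -> nat_of_ord (ord_pred b) = b.-1.
Proof.
move=> b0; have bh := ltn_ord b; rewrite /=.
have -> : (b + h).-1 = b.-1 + h by clear -b0; lia.
by rewrite modnDr modn_small //; clear -bh; lia.
Qed.

Let ordSE (b : 'I_h) : b.+1 < h -> nat_of_ord (ordS b) = b.+1.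
Proof. by move=> bh; rewrite /= modn_small. Qed.

Lemma corner_bound d : (forall x, d <= #|[set y | adj x y]|) ->
  2 * h.+1 * d + 2 * (j * j) + 2 * h + 2 <= 2 * #|V| + 2 * h * h.
Proof.
move=> dmin.
have HZ1 i b : b \in Z1 i -> [/\ b != i, ~~ adj (u i) (u b) &
    forall o, o \in A0 -> o \notin warc u 0 h -> adj o (u (ordS i)) -> adj o (u (ordS b)) -> False].
  rewrite inE /top; case: ifP => [sD|_]; last case: ifP => [sh|_]; last by clear; lia.
    rewrite /lo /side in sD * => hb.
    have Ei : nat_of_ord i = D - 1 - (D - 1 - i) by clear -sD; lia.
    have Eb : nat_of_ord b = h - 1 - (h - 1 - b) by clear -hb; lia.
    split.
    - by rewrite -val_eqE /=; clear -sD hb jD Dj; lia.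
    - by rewrite Ei Eb; apply: nonadj; clear -sD hb jD Dj; lia.
    move=> o oA oQ; rewrite !ordSE; [|by clear -hb; lia|by clear -sD Dj; lia].
    have -> : i.+1 = D - 1 - (D - 2 - i) by clear -sD; lia.
    have -> : b.+1 = h - 1 - (h - 2 - b) by clear -hb; lia.
    by apply: no_common => //; clear -sD hb jD Dj; lia.
  rewrite /lo /side in sh * => hb.
  have Ei : nat_of_ord i = h - 1 - (h - 1 - i) by clear -sh; lia.
  have Eb : nat_of_ord b = D - 1 - (D - 1 - b) by clear -hb; lia.
  split.
  - by rewrite -val_eqE /=; clear -sh hb jD Dj; lia.
  - by rewrite adj_sym Ei Eb; apply: nonadj; clear -sh hb jD Dj; lia.
  move=> o oA oQ; rewrite !ordSE; [|by clear -hb Dj; lia|by clear -sh; lia].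
  have -> : i.+1 = h - 1 - (h - 2 - i) by clear -sh; lia.
  have -> : b.+1 = D - 1 - (D - 2 - b) by clear -hb; lia.
  by move=> oi ob; apply: no_common oA oQ ob oi; clear -sh hb jD Dj; lia.
have HZ2 i b : b \in Z2 i -> [/\ b != ordS i, ~~ adj (u (ordS i)) (u b) &
    forall o, o \in A0 -> o \notin warc u 0 h -> adj o (u i) -> adj o (u (ord_pred b)) -> False].
  rewrite inE /top; case: ifP => [sD|_]; last case: ifP => [sh|_]; last by clear; lia.
    rewrite /lo /side in sD * => hb.
    have Ei : i.+1 = D - 1 - (D - 2 - i) by clear -sD; lia.
    have Eb : nat_of_ord b = h - 1 - (h - 1 - b) by clear -hb; lia.
    have iS : i.+1 < h by clear -sD Dj; lia.
    split.
    - apply/eqP => /(congr1 (@nat_of_ord h)); rewrite ordSE //; clear -sD hb jD Dj; lia.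
    - by rewrite ordSE // Ei Eb; apply: nonadj; clear -sD hb jD Dj; lia.
    move=> o oA oQ; rewrite ord_predE; last by clear -sD hb jD Dj; lia.
    have -> : nat_of_ord i = D - 1 - (D - 1 - i) by clear -sD; lia.
    have -> : b.-1 = h - 1 - (h - b) by clear -hb; lia.
    by apply: no_common => //; clear -sD hb jD Dj; lia.
  rewrite /lo /side in sh * => hb.
  have Ei : i.+1 = h - 1 - (h - 2 - i) by clear -sh; lia.
  have Eb : nat_of_ord b = D - 1 - (D - 1 - b) by clear -hb; lia.
  have iS : i.+1 < h by clear -sh; lia.
  split.
  - apply/eqP => /(congr1 (@nat_of_ord h)); rewrite ordSE //; clear -sh hb jD Dj; lia.
  - by rewrite adj_sym ordSE // Ei Eb; apply: nonadj; clear -sh hb jD Dj; lia.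
  move=> o oA oQ; rewrite ord_predE; last by clear -sh hb jD Dj; lia.
  have -> : nat_of_ord i = h - 1 - (h - 1 - i) by clear -sh; lia.
  have -> : b.-1 = D - 1 - (D - b) by clear -hb; lia.
  by move=> oi ob; apply: no_common oA oQ ob oi; clear -sh hb jD Dj; lia.
(* The sizes are at most 2 j - 1 <= h - 3, and h (h - 3) < (h - 1) (h - 2). *)
have Zsmall i : h * (#|Z1 i| + #|Z2 i|) <= h.-1 * h.-2.
  have le : #|Z1 i| + #|Z2 i| <= h - 3.
    rewrite card_Z /side; have := ltn_ord i.
    by case: ifP => [|_]; [|case: ifP]; clear -jD Dj; lia.
  apply: leq_trans (leq_mul (leqnn h) le) _; have : 4 <= h by clear -jD Dj; lia.
  by clear; nia.
have := spoke_bound adj_sym adj_irr ccyc maxc uh uA maxh HZ1 HZ2 Zsmall hc dmin.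
suff : 2 * (j * j) <= \sum_i (#|Z1 i| + #|Z2 i|).
  by move: (\sum_i (#|Z1 i| + #|Z2 i|)) (h.+1 * d) (h * h) (j * j) => S x y z; clear; lia.
pose g n := if side D n then (2 * (n - (D - 1 - j))).+1 else
  if side h n then (2 * (n - (h - 1 - j))).+1 else 0.
rewrite (eq_bigr (fun i : 'I_h => g i)); last by move=> i _; rewrite card_Z.
rewrite -(big_mkord xpredT g).
have part m : m = D \/ m = h -> \sum_(m - 1 - j <= n < m - 1) g n = j * j.
  move=> mE; have jm : j + 2 <= m by case: mE => ->; clear -jD Dj; lia.
  rewrite -sum_odd -{1}(add0n (m - 1 - j)) -{2}(subnK (_ : m - 1 - j <= m - 1)); last by clear; lia.
  rewrite big_addn addnK (_ : m - 1 - (m - 1 - j) = j); last by clear -jm; lia.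
  apply: eq_big_nat => e ej; rewrite /g /side; case: mE => ->.
    case: ifP; clear -ej jD Dj; last by lia.
    by rewrite addnK.
  case: ifP; first by clear -ej jD Dj; lia.
  by case: ifP; rewrite ?addnK //; clear -ej jD Dj; lia.
rewrite (@big_cat_nat _ _ _ (D - 1 - j)) //=; last by clear -Dj; lia.
rewrite (@big_cat_nat _ _ _ (D - 1) (D - 1 - j)) /=; [|by clear; lia|by clear -Dj; lia].
rewrite (@big_cat_nat _ _ _ (h - 1 - j) (D - 1)) /=; [|by clear -Dj; lia|by clear; lia].
rewrite (@big_cat_nat _ _ _ (h - 1) (h - 1 - j)) /=; [|by clear; lia|by clear; lia].
rewrite (part D (or_introl erefl)) (part h (or_intror erefl)).
by move: (\sum_(0 <= _ < _) _) (\sum_(_ <= _ < h - 1 - j) _) (\sum_(h - 1 <= _ < h) _) (j * j); clear; lia.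
Qed.

End CornerBound.

Lemma periodic_extension (l : seq nat) c : l != [::] -> sorted ltn l -> all (ltn^~ c) l ->
  exists A : nat -> nat, [/\ forall m, A m < A m.+1, forall m, A (m + size l) = A m + c &
    forall m, exists q, A m = nth 0 l (m %% size l) + q * c].
Proof.
move=> l0 sl lc; set t := size l; have t0 : 0 < t by rewrite lt0n size_eq0.
have lt_c m : nth 0 l (m %% t) < c by apply: (all_nthP 0 lc); rewrite ltn_mod.
exists (fun m => nth 0 l (m %% t) + m %/ t * c); split=> m.
- have mt := ltn_pmod m t0; have Em := divn_eq m t.
  have [lt|E] : (m %% t).+1 < t \/ (m %% t).+1 = t by clear -mt; lia.
    have -> : m.+1 %% t = (m %% t).+1 by rewrite -addn1 -modnDml addn1 modn_small.
    have -> : m.+1 %/ t = m %/ t by rewrite {1}Em -addnS divnMDl // (divn_small lt) addn0.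
    by rewrite ltn_add2r; apply: (sorted_ltn_nth ltn_trans 0 sl); rewrite ?inE // ltnW.
  have -> : m.+1 %/ t = (m %/ t).+1 by rewrite {1}Em -addnS E divnMDl // divnn t0 addn1.
  by rewrite mulSn; have := lt_c m; move: (nth _ _ _) (nth _ _ _) (_ * c); clear; lia.
- by rewrite modnDr divnDr ?dvdnn // divnn t0 addn1 mulSn; clear; lia.
by exists (m %/ t).
Qed.

(** * Combining the bounds *)

Section Core.

Variables (V : finType) (adj : rel V).
Hypotheses (adj_sym : symmetric adj) (adj_irr : irreflexive adj).
Variables (cc : nat -> V) (c : nat).
Hypotheses (ccyc : cyclic_walk adj cc c) (maxc : cycle_bound adj predT c).
Let A0 := ~: [set y in warc cc 0 c].
Variables (u : nat -> V) (h : nat).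
Hypotheses (uh : cyclic_walk adj u h) (uA : forall i, u i \in A0).
Hypothesis maxh : cycle_bound adj [in A0] h.
Variables k lam : nat.
Hypotheses (k0 : 0 < k) (lam0 : 0 < lam) (lamh : lam <= h).
Hypothesis dmin : forall x, k + lam - 1 <= #|[set y | adj x y]|.
Hypothesis order_le : #|V| + 2 <= lam.+1 * k.+1.
Hypothesis conn : forall S : {set V}, #|S| < k -> forall x y, x \notin S -> y \notin S ->
  exists s, chain adj x s y /\ forall z, z \in s -> z \notin S.

Let Q := [set y in warc u 0 h].
Let C := [set y in warc cc 0 c].

Let cardQ : #|Q| = h.
Proof. by rewrite cardsE (card_uniqP (uniq_warc uh _ _)) // size_warc. Qed.

Let cardC : #|C| = c.
Proof. by rewrite cardsE (card_uniqP (uniq_warc ccyc _ _)) // size_warc. Qed.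

Let inQ v : reflect (exists i, v = u i) (v \in Q).
Proof. by rewrite inE; apply: (mem_warc_full uh). Qed.

Let order_ge : c + h <= #|V|.
Proof.
rewrite -(cardsC C) cardC leq_add2l -cardQ; apply/subset_leq_card/subsetP => v.
by case/inQ => i ->; apply: uA.
Qed.

Let h_le_c : h <= c.
Proof.
case: (ltnP 1 h) => h1; last by apply: leq_trans h1 (cw_gt0 ccyc).
rewrite -[h](size_warc u 0); apply: maxc => //; last exact: (uniq_warc uh).
have := chain_warc uh 0 (n := h.-1) ltac:(lia); rewrite prednK; last by lia.
move/chain_cycle; apply; rewrite add0n -(cw_period uh 0) add0n.
by rewrite -{2}(prednK (cw_gt0 uh)); apply: cw_adj uh _ h1.
Qed.

Let deg_lt_c : k + lam - 1 < c.
Proof.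
have [|v _ vc] := low_degree_vertex adj_sym adj_irr ccyc (A0 := setT) (fun=> in_setT _).
  by move=> s cs us _; apply: maxc.
apply: leq_ltn_trans (dmin v) (leq_ltn_trans _ vc).
by apply/subset_leq_card/subsetP => y; rewrite !inE.
Qed.

Let small_case : h = lam \/ h <= k -> False.
Proof.
(* Either way h <= k + lam - 1, which is below c by [deg_lt_c]. *)
move=> H; have hc : h < c by case: H; move: deg_lt_c lamh k0 lam0; clear; lia.
have := spoke_bound (Z1 := fun=> set0) (Z2 := fun=> set0) adj_sym adj_irr ccyc maxc uh uA maxh _ _ _ hc dmin.
rewrite big1; last by move=> i _; rewrite !cards0.
move=> SB; have {}SB : 2 * h.+1 * (k + lam - 1) + 2 * h + 2 <= 2 * #|V| + 2 * h * h.
  rewrite -[2 * h.+1 * _]addn0; apply: SB => [i b|i b|i]; rewrite ?in_set0 //.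
  by rewrite !cards0 muln0.
move: SB order_le k0 lam0 lamh; move: #|V| => n; clear -H; case: H => [->|hk]; nia.
Qed.

(** The attachments, sorted along C and continued periodically, form the sequence [A] for
    [successor_degree_sum]. The successors see nothing of Q, because every vertex of Q is reached
    from each attachment down its leg and along the cycle. *)
Let all_bypassed t (E PO : 'I_t -> nat) (AL : 'I_t -> seq V) (Z : 'I_t -> V) :
  1 < t -> t = minn k lam.+1 -> lam < h ->
  (forall p, leg adj A0 u h (E p) (AL p) (Z p)) -> (forall p, adj (Z p) (cc (PO p))) ->
  (forall p, PO p < c) -> injective PO ->
  (forall p q, p != q -> bypass adj cc c (PO p) (PO q) t.-1) -> False.
Proof.
move=> t1 tE lh legP zP POc PO_inj good.
pose l := sort leq [seq PO p | p <- enum 'I_t].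
have size_l : size l = t by rewrite size_sort size_map size_enum_ord.
have mem_l a : a \in l -> exists p, a = PO p by rewrite mem_sort => /mapP[p _ ->]; exists p.
have ul : uniq l by rewrite sort_uniq map_inj_uniq ?enum_uniq.
have sl : sorted ltn l.
  by rewrite ltn_sorted_uniq_leq ul sort_sorted //; apply: leq_total.
have lc : all (ltn^~ c) l by apply/allP => a /mem_l[p ->]; apply: POc.
have l0 : l != [::] by rewrite -size_eq0 size_l; clear -t1; lia.
have [A [stepA perA repA]] := periodic_extension l0 sl lc.
rewrite size_l in perA repA.
have ntl m : m %% t < size l by rewrite size_l ltn_mod; clear -t1; lia.
have repP m : exists p, PO p = nth 0 l (m %% t) /\ forall i, cc (A m + i) = cc (PO p + i).
  have [p Ep] := mem_l _ (mem_nth 0 (ntl m)); exists p; split=> // i.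
  have [q ->] := repA m; rewrite -Ep addnAC; exact: (cw_periodM ccyc).
have cc0 m p : (forall i, cc (A m + i) = cc (PO p + i)) -> cc (A m) = cc (PO p).
  by move=> /(_ 0); rewrite !addn0.
have byp i i' : i < i' -> i' < i + t -> bypass adj cc c (A i) (A i') t.-1.
  move=> ii it; have [p [Ep Cp]] := repP i; have [q [Eq Cq]] := repP i'.
  rewrite /bypass (cc0 _ _ Cp) (cc0 _ _ Cq); apply: good.
  apply/eqP => pq; move: Ep; rewrite pq Eq => /eqP; rewrite nth_uniq // eq_sym => /eqP E'.
  have := divn_eq i t; have := divn_eq i' t; rewrite E'.
  move: (i %% t) (i %/ t) (i' %/ t) => r x y; clear -ii it t1 => Ei' Ei.
  by have [lt|ge] := ltnP x y; nia.
(* An outside vertex reached from an attachment by an outside path is not adjacent to the successor: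
   [insertion] with l = 1 leaves no room. *)
have step_excluded m z : z \notin warc cc 0 c -> (exists2 d, size d > 0 /\ uniq d & exists x,
    [/\ chain adj x d z, off cc c d & adj (cc (A m)) x]) -> adj (cc (A m).+1) z -> False.
  move=> zC [d [d0 ud] [x [cd od mx]]] mz.
  have := insertion ccyc maxc (l := 1) _ cd ud od mx.
  rewrite addn1 adj_sym => /(_ _ mz) H; have : size d < 1 by apply: H; rewrite /=; exact: cw_gt0 ccyc.
  by clear -d0; lia.
have off_u i : u i \notin warc cc 0 c by have := uA i; rewrite !inE.
have := successor_degree_sum adj_sym adj_irr ccyc maxc t1 stepA perA byp (D := Q) dmin.
rewrite cardQ => SD.
have {}SD : t * (k + lam - 1) + h + t * 2 <= #|V| + t * t.
  apply: SD.
  - by move=> z /inQ[i ->].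
  - move=> i z _ /inQ[f Ez]; apply/negP => iz.
    have [p [_ Cp]] := repP i; have [cp up sp Qp] := legP p.
    have [n nh En] : exists2 n, n < h & u (E p + n) = z.
      have : z \in warc u (E p) h by apply/(mem_warc_full uh); exists f.
      case/mem_warc => n hn ->; exists (n - E p); first by clear -hn; lia.
      by congr u; clear -hn; lia.
    have [c1 u1 s1] := leg_walk adj_sym uh uA (legP p) nh; rewrite En in c1.
    apply: (step_excluded i z) iz; first by rewrite Ez.
    exists (rev (AL p) ++ warc u (E p).+1 n); first by rewrite (chain_size c1).
    exists (Z p); split=> //; first by move=> v /s1; rewrite !inE.
    by rewrite (cc0 _ _ Cp) adj_sym.
  move=> i i' o ii it oC io i'o.
  have [d [x [y [cd ud od ix [yi' _]]]]] := byp i i' ii (leq_trans it (leq_addl _ _)).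
  (* If [o] is on the bypass, the part of the bypass up to [o] could be inserted before the
     successor. *)
  case: (boolP (o \in d)) => [od'|od'].
    have [s1 [s2 [Ed c1 c2]]] := chain_prefix cd od'.
    apply: (step_excluded i o oC) io; exists (rcons s1 o).
      by rewrite size_rcons; split=> //; move: ud; rewrite Ed -cat_rcons cat_uniq => /and3P[].
    exists x; split=> // v vs; apply: od; by rewrite Ed -cat_rcons mem_cat vs.
  apply: (no_common_neighbor adj_sym ccyc maxc _ _ cd ud od ix yi' oC od' io i'o).
    exact: increasing_of_step.
  by rewrite -perA; apply: increasing_of_step => //; apply: leq_trans it (leq_addl _ _).
move: SD order_le k0 lam0 lh tE; move: #|V| => n; clear.
case: k => // k'; rewrite addSn subn1 /= /minn.
by case: (ltnP k'.+1 lam.+1) => _ SD ole _ l0' lh' tE'; rewrite tE' in SD; nia.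
Qed.

Let large_case : lam < h -> k < h -> 1 < k -> False.
Proof.
move=> lh kh k1; pose t := minn k lam.+1.
have tk : t <= k by rewrite geq_minl.
have th : t <= h by apply: leq_trans (ltnW kh); exact: tk.
have t1 : 1 < t by rewrite /t; move: k1 lam0; clear; lia.
have [F [lF dF]] : exists F : 'I_t -> seq V, linkage adj Q C F.
  (* A separator smaller than t <= k misses some vertex of Q and some vertex of C, and these are
     still joined outside it. *)
  apply: menger => S sepS; rewrite leqNgt; apply/negP => St.
  have ex (X : {set V}) : t <= #|X| -> exists2 x, x \in X & x \notin S.
    move=> tX; case: (pickP [pred x | (x \in X) && (x \notin S)]) => [x /andP[]|none].
      by exists x.
    have : X \subset S by apply/subsetP => x xX; have := none x; rewrite /= xX /= => /negbFE.
    by move/subset_leq_card; move: tX St; clear; lia.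
  have [x xQ xS] := ex Q (eq_ind_r (leq t) th cardQ).
  have [y yC yS] := ex C (eq_ind_r (leq t) (leq_trans th h_le_c) cardC).
  have [s [cs sS]] := conn (leq_trans St tk) xS yS.
  by have [z /sS/negP] := sepS x s y cs xQ yC.
have legs p : exists q : nat * seq V * V * nat,
    [/\ leg adj A0 u h q.1.1.1 q.1.1.2 q.1.2, adj q.1.2 (cc q.2), q.2 < c,
      {subset q.1.1.2 <= F p} & cc q.2 \in F p].
  have [x [y [ch uF xQ yC tr]]] := lF p; have [e Ex] := elimT (inQ x) xQ.
  have yF := chain_last ch; have xF := chain_head ch.
  have xy : x != y.
    by apply: contraTneq yC => <-; have := uA e; rewrite -Ex !inE.
  case/lastP EF : (F p) ch => [//|al y'] ch; have Ey := chain_lastE ch; subst y'.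
  case/lastP Eal : al ch => [|al' z] ch.
    by have := chain_headE ch; move/eqP; rewrite eq_sym (negPf xy).
  have /andP[c1 c2] : chain adj x (rcons al' z) z && chain adj z [:: z; y] y.
    by move: ch; rewrite -cats1 cat_rcons chain_split.
  move: yC; rewrite inE => /mem_warc[a ac Ea].
  have yal : y \notin al by move: uF; rewrite EF rcons_uniq => /andP[].
  have alF v : v \in al -> v \in F p by rewrite EF mem_rcons inE => ->; rewrite orbT.
  exists (e, al, z, a); split=> /=.
  - split; rewrite -?Ex ?Eal //.
    + by move: uF; rewrite EF rcons_uniq Eal => /andP[].
    + rewrite -Eal => v va; rewrite !inE; apply/negP => vC.
      have [_ vy] := tr v (alF v va); move: yal; rewrite -(vy _) ?va //.
      by rewrite inE.
    rewrite -Eal => v va vQ; have [vx _] := tr v (alF v va).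
    by apply: vx; rewrite inE.
  - by rewrite -Ea; move: c2 => /=; rewrite !eqxx /= => /andP[/andP[]].
  - by move: ac.
  - by rewrite -Eal -EF; apply: alF.
  by rewrite -Ea mem_rcons mem_head.
have [g Hg] := functional_choice _ legs.
pose E p := (g p).1.1.1; pose AL p := (g p).1.1.2; pose Z p := (g p).1.2; pose PO p := (g p).2.
have legP p : leg adj A0 u h (E p) (AL p) (Z p) by case: (Hg p).
have zP p : adj (Z p) (cc (PO p)) by case: (Hg p).
have POc p : PO p < c by case: (Hg p).
have ALdisj p q v : p != q -> v \in AL p -> v \in AL q -> False.
  move=> pq; case: (Hg p) => _ _ _ sp _; case: (Hg q) => _ _ _ sq _ /sp vp /sq vq.
  by rewrite (dF _ _ _ vp vq) eqxx in pq.
have PO_inj : injective PO.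
  move=> p q Epq; case: (Hg p) => _ _ _ _ sp; case: (Hg q) => _ _ _ _ sq.
  by apply: dF sp _; rewrite -/(PO p) Epq.
have offE d : {subset d <= A0} <-> off cc c d.
  by split=> H z /H; rewrite !inE.
case: (classic (forall p q, p != q -> bypass adj cc c (PO p) (PO q) t.-1)) => [good|].
  exact: all_bypassed legP zP POc PO_inj good.
move=> nH; have [p Hp] := not_all_ex_not _ _ nH; have [q Hq] := not_all_ex_not _ _ Hp.
have [pq bad] := imply_to_and _ _ Hq => {nH Hp Hq}.
(* The cycle is renumbered so that leg [p] starts at position 0 and leg [q] at position [D]. *)
pose u' i := u (E p + i); pose D := (E q + h - E p %% h) %% h.
have h0 := cw_gt0 uh; have uh' : cyclic_walk adj u' h := cw_rot uh (E p).
have uD : u' D = u (E q).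
  apply/eqP; rewrite (cw_eq uh) modnDmr -modnDml subnKC; last first.
    by apply: ltnW; apply: leq_trans (ltn_pmod _ h0) _; rewrite leq_addl.
  by rewrite modnDr.
have Dh : D < h by rewrite ltn_mod.
have memQ v : (v \in warc u' 0 h) = (v \in warc u 0 h).
  by rewrite /u' warc_rot; apply/(mem_warc_full uh)/(mem_warc_full uh).
have [cp up sp Qp] := legP p; have [cq uq sq Qq] := legP q.
have lx : leg adj A0 u' h 0 (AL p) (Z p).
  by split; rewrite /u' ?addn0 // => v va; rewrite memQ; apply: Qp.
have ly : leg adj A0 u' h D (AL q) (Z q).
  by split; rewrite ?uD // => v va; rewrite memQ; apply: Qq.
have D0 : 0 < D.
  rewrite lt0n; apply/eqP => D0; move: uD; rewrite D0 /u' addn0 => EE.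
  by apply: (ALdisj p q (u (E p)) pq); [exact: chain_head cp|rewrite EE; exact: chain_head cq].
have axy v : v \in AL p -> v \in AL q -> False by apply: ALdisj pq.
have uA' i : u' i \in A0 by apply: uA.
(* A detour has at most t - 2 vertices, that is, size d + j < h. *)
pose j := h.+1 - t.
have short d a b : chain adj a d b -> uniq d -> {subset d <= A0} ->
    adj (cc (PO p)) a -> adj b (cc (PO q)) -> size d + j < h.
  move=> cd ud sd pa bq; case: (leqP t.-1 (size d)) => sz.
    by case: bad; exists d, a, b; split=> //; apply/offE.
  by move: sz; rewrite /j; move: (size d) => z; clear -t1 th; lia.
have [jD Dj] := corner_room adj_sym uh' uA' D0 Dh lx ly axy (zP p) (zP q) short.
have [d1 [c1 u1 s1 z1]] := forward_route adj_sym uh' uA' D0 Dh lx ly axy.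
have [d2 [c2 u2 s2 z2]] := backward_route adj_sym uh' uA' D0 Dh lx ly axy.
have pz : adj (cc (PO p)) (Z p) by rewrite adj_sym.
have qz : adj (cc (PO q)) (Z q) by rewrite adj_sym.
(* Inserting one route into each arc of C between the two attachments shows that c is at least (D +
   2) + (h - D + 2). *)
have hc : h < c.
  have ins a b d x y : a < b -> b < c -> chain adj x d y -> uniq d -> {subset d <= A0} ->
      adj (cc a) x -> adj y (cc b) -> size d < b - a /\ size d < a + c - b.
    move=> ab bc cd ud /offE od ax yb; split.
      apply: (insertion ccyc maxc _ cd ud od ax); first by clear -ab bc; lia.
      by rewrite subnKC // ltnW.
    rewrite -size_rev; apply: (insertion ccyc maxc (a := b) _ (chain_rev adj_sym cd)).
    - by clear -ab bc; lia.
    - by rewrite rev_uniq.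
    - by move=> z; rewrite mem_rev; apply: od.
    - by rewrite adj_sym.
    by rewrite subnKC ?(cw_period ccyc) 1?adj_sym //; clear -bc; lia.
  case: (ltngtP (PO p) (PO q)) => [lt|lt|E']; last by move: pq; rewrite (PO_inj _ _ E') eqxx.
    have [+ _] := ins _ _ _ _ _ lt (POc q) c1 u1 s1 pz (zP q).
    have cr := chain_rev adj_sym c2; have [] := ins _ _ (rev d2) _ _ lt (POc q) cr _ _ pz (zP q).
    - by rewrite rev_uniq.
    - by move=> z; rewrite mem_rev; apply: s2.
    rewrite size_rev => _; move: (size d1) (size d2) z1 z2 => x y.
    by have := POc q; clear -lt Dh D0; lia.
  have [+ _] := ins _ _ _ _ _ lt (POc p) c2 u2 s2 qz (zP p).
  have cr := chain_rev adj_sym c1; have [] := ins _ _ (rev d1) _ _ lt (POc p) cr _ _ qz (zP p).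
  - by rewrite rev_uniq.
  - by move=> z; rewrite mem_rev; apply: s1.
  rewrite size_rev => _; move: (size d1) (size d2) z1 z2 => x y.
  by have := POc p; clear -lt Dh D0; lia.
have nonadj al be := corner_nonadj adj_sym uh' uA' D0 Dh lx ly axy (zP p) (zP q) short (al := al) (be := be).
have no_common al be o := corner_no_common adj_sym uh' uA' D0 Dh lx ly axy (zP p) (zP q) short (al := al) (be := be) (o := o).
have := corner_bound adj_sym adj_irr ccyc maxc uh' uA' maxh hc jD Dj nonadj no_common dmin.
have AB : (h - lam) * (h - k) <= j * j by apply: leq_mul; rewrite /j /t; clear; lia.
move: AB order_le lh kh k0 lam0; move: #|V| (j * j) => n jj; clear; nia.
Qed.

Lemma long_cycle_off_absurd : False.
Proof.
have [hl|lh] := eqVneq h lam; first by apply: small_case; left.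
have {}lh : lam < h by rewrite ltn_neqAle eq_sym lh.
case: (leqP h k) => kh; first by apply: small_case; right.
(* A single path gives no pair of attachments; but for k = 1 the order is at most 2 lam, against c +
   h >= 2 h. *)
have [k1|k1] := eqVneq k 1; last by apply: large_case => //; move: k0 k1; clear; lia.
by move: order_le order_ge h_le_c lh; rewrite k1; move: #|V|; clear; lia.
Qed.

End Core.

(** * From the definitions of the statement to cyclic walks *)

Lemma big_minn_le (I : eqType) (r : seq I) (P : pred I) (F : I -> nat) d x :
  x \in r -> P x -> \big[minn/d]_(y <- r | P y) F y <= F x.
Proof.
elim: r => // a r IH; rewrite inE big_cons => /orP[/eqP<- Px|xr Px].
  by rewrite Px geq_minl.
by case: ifP => _; [apply: leq_trans (geq_minr _ _) _|]; apply: IH.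
Qed.

Section Translation.

Variables (V : finType) (adj : rel V).

Lemma min_degree_le x : min_degree adj <= degree adj x.
Proof. by apply: big_minn_le; rewrite ?mem_index_enum. Qed.

(** A set with fewer than [k] vertices is not among those over which [connectivity] minimises. *)
Lemma connected_avoiding k (S : {set V}) : k_connected adj k -> #|S| < k ->
  forall x y, x \notin S -> y \notin S ->
  exists s, chain adj x s y /\ forall z, z \in s -> z \notin S.
Proof.
rewrite /k_connected => kc Sk x y xS yS.
have : connected_on adj (~: S).
  apply/negPn/negP => dis; move: Sk; rewrite ltnNge => /negP; apply.
  by apply: leq_trans kc _; apply: big_minn_le; rewrite ?mem_index_enum // dis.
move/forall_inP/(_ x); rewrite inE => /(_ xS) /forall_inP/(_ y); rewrite inE => /(_ yS).
case/connectP => p ep ->; exists (x :: p); split.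
  rewrite /= !eqxx andbT; apply: sub_path ep => a b /and3P[] //.
move=> z; rewrite inE => /orP[/eqP->//|].
elim: p x {xS} ep => //= a p IH x /andP[/and3P[_ aS _] ep].
by rewrite inE => /orP[/eqP->|]; [rewrite inE in aS|apply: IH ep].
Qed.

Lemma cyclic_walk_of_cycle x0 s : is_cycle adj s ->
  cyclic_walk adj (fun i => nth x0 s (i %% size s)) (size s).
Proof.
move=> /and3P[s0 us cs]; split=> // [i|i j ih jh|i h1].
- by rewrite modnDr.
- by rewrite !modn_small // => /eqP; rewrite nth_uniq // => /eqP.
case: s s0 us cs h1 => // x p _ us; rewrite /= => cs h1.
have {cs h1} /pathP cs : path adj x (rcons p x) by move: cs h1; case: p {us}.
have im := ltn_pmod i (ltn0Sn (size p)).
have := cs x0 (i %% (size p).+1); rewrite size_rcons => /(_ im).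
rewrite -rcons_cons nth_rcons /= im nth_rcons.
have [lt|E] : (i %% (size p).+1).+1 < (size p).+1 \/ (i %% (size p).+1).+1 = (size p).+1.
- by clear -im; lia.
- rewrite -ltnS lt.
  by rewrite -[i.+1]addn1 -modnDml addn1 (modn_small lt).
have -> : i.+1 %% (size p).+1 = 0 by rewrite -addn1 -modnDml addn1 E modnn.
by case: E => E; rewrite E ltnn eqxx.
Qed.

Lemma mem_cycle_warc (x0 : V) (s : seq V) : 0 < size s ->
  warc (fun i => nth x0 s (i %% size s)) 0 (size s) = s.
Proof.
move=> s0; apply: (@eq_from_nth _ x0); rewrite size_warc // => i ih.
by rewrite (nth_map 0) ?size_iota // nth_iota // modn_small.
Qed.

Lemma max_cycle_orderP (A : {set V}) : 0 < max_cycle_order adj A ->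
  (exists s, [/\ is_cycle adj s, {subset s <= A} & size s = max_cycle_order adj A]) /\
  (forall s, cycle adj s -> uniq s -> {subset s <= A} -> size s <= max_cycle_order adj A).
Proof.
pose P (t : 'I_#|V|.+1) := [exists s : t.-tuple V, is_cycle adj s && all [in A] s].
rewrite /max_cycle_order -/P => pos; split; last first.
  move=> s cs us sA; case: s cs us sA => // x s cs us sA.
  have sV : size (x :: s) < #|V|.+1 by rewrite ltnS -(card_uniqP us) max_card.
  apply: (bigmax_sup (Ordinal sV)) => //; apply/existsP; exists (in_tuple (x :: s)).
  by rewrite /is_cycle us cs orbT; apply/allP.
(* A positive maximum is not the default 0 of an empty range, so it is attained. *)
have [t Pt Et] : exists2 t, P t & \max_(t | P t) (t : nat) = t.
  have : 0 < #|P|.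
    rewrite lt0n; apply/negP => /eqP /card0_eq P0; move: pos; rewrite big_pred0 //.
  by case/(eq_bigmax_cond (fun t : 'I_#|V|.+1 => (t : nat))) => t Pt Et; exists t.
rewrite Et; case/existsP: Pt => s /andP[cs /allP sA]; exists s; split=> //.
by rewrite size_tuple.
Qed.

End Translation.

Import Order.TTheory GRing.Theory Num.Theory.

(** The denominator is cleared; as lambda <= d, the truncated subtraction agrees with the rational
    one. *)
Lemma order_bound_nat (n lambda d : nat) : lambda <= d ->
  ((n%:R + 2) / (lambda%:R + 1) + lambda%:R - 2 <= d%:R :> rat)%R ->
  n + 2 <= lambda.+1 * (d - lambda + 1).+1.
Proof.
move=> ld H.
have l0 : (0 < lambda%:R + 1 :> rat)%R by rewrite -[1%R]/(1%:R)%R -natrD ltr0n addn1.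
have {}H : ((n%:R + 2) / (lambda%:R + 1) <= (d - lambda + 2)%:R :> rat)%R.
  rewrite natrD natrB //; move: H; rewrite lerBlDr -lerBrDr => H.
  by apply: le_trans H _; rewrite addrAC.
move: H; rewrite ler_pdivrMr // -[1%R]/(1%:R)%R -[2%R]/(2%:R)%R -!natrD -natrM ler_nat.
by rewrite mulnC addn1 -addnS.
Qed.

Local Open Scope ring_scope.

Theorem theorem2 (V : finType) (adj : rel V)
    (adj_sym : symmetric adj) (adj_irr : irreflexive adj)
    (lambda : nat) (lambda_gt0 : (1 <= lambda)%N)
    (lambda_le : (lambda <= min_degree adj)%N)
    (conn : k_connected adj (min_degree adj - lambda + 1)%N)
    (C : seq V) (C_longest : longest_cycle adj C)
    (delta_ge : (#|V|%:R + 2) / (lambda%:R + 1) + lambda%:R - 2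
                  <= (min_degree adj)%:R :> rat) :
  (cbar adj C <= lambda - 1)%N.
Proof.
rewrite leqNgt; apply/negP => lt.
have lamh : (lambda <= cbar adj C)%N by move: lt; rewrite subn1 prednK.
have [[Q [cQ sQ sizeQ]] maxQ] := max_cycle_orderP (leq_trans lambda_gt0 lamh).
case: C_longest => cC maxC; have /and3P[C0 uC _] := cC; have /and3P[Q0 uQ _] := cQ.
have [x0 _] : exists x, x \in C by case: (C) C0 => // x s _; exists x; rewrite mem_head.
have ccyc := cyclic_walk_of_cycle x0 cC; have uh := cyclic_walk_of_cycle x0 cQ.
have warcC := mem_cycle_warc x0 C0.
apply: (long_cycle_off_absurd adj_sym adj_irr ccyc _ uh _ _ (k := (min_degree adj - lambda + 1)%N) (lam := lambda)).
- move=> s cs us _; case: s cs us => // x s cs us; apply: maxC.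
  by rewrite /is_cycle us cs orbT.
- move=> i; rewrite warcC; have /sQ : nth x0 Q (i %% size Q) \in Q by rewrite mem_nth ?ltn_mod.
  by rewrite !inE.
- rewrite warcC sizeQ => s cs us sA; apply: maxQ => // z /sA.
  by rewrite !inE.
- by rewrite addn1.
- done.
- by rewrite sizeQ.
- by move=> x; rewrite addn1 addSn subn1 /= subnK //; apply: min_degree_le.
- exact: order_bound_nat.
by move=> S Sk; apply: connected_avoiding conn Sk.
Qed.
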